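(* Let $G$ be a compact metrizable group with normalized Haar measure $\mu$. Let $X_1, X_2, \dots$ be i.i.d. $G$-valued random variables with distribution $\nu$ (a Borel probability measure on $G$), and set $S_k = X_1 X_2 \cdots X_k$. The following are equivalent. (i) $\nu$ is adapted, and $(\nu^{*k})_{\mathrm{abs}} \neq 0$ for some $k \ge 1$. (ii) For any bounded, Borel measurable function $f: G \to \mathbb{R}$, \[ \lim_{N \to \infty} \frac{1}{N} \sum_{k=1}^N f(S_k) = \int_G f \, \mathrm{d}\mu \quad \text{almost surely}. \] (iii) For any bounded, Borel measurable function $f: G \to \mathbb{R}$, \[ \limsup_{N \to \infty} \frac{\left| \sum_{k=1}^N f(S_k) - N \int_G f \, \mathrm{d}\mu \right|}{\sqrt{N \log\log N}} < \infty \quad \text{almost surely}. \]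
   Context: A Borel probability measure $\nu$ on $G$ is called adapted if its support (the smallest closed set of full $\nu$-measure) is not contained in any proper closed subgroup of $G$. $\nu^{*k}$ denotes the $k$-fold convolution of $\nu$ (the distribution of $S_k$). Its Lebesgue decomposition with respect to $\mu$ is $\nu^{*k} = (\nu^{*k})_{\mathrm{abs}} + (\nu^{*k})_{\mathrm{sing}}$, where $(\nu^{*k})_{\mathrm{abs}}$ is absolutely continuous and $(\nu^{*k})_{\mathrm{sing}}$ is singular with respect to $\mu$. $\mu$ is normalized so that $\mu(G)=1$. *)

(* Defs.v *)
From HB Require Import structures.
From mathcomp Require Import all_boot all_order all_algebra.
From mathcomp Require Import finmap.
From mathcomp Require Import all_classical all_reals all_analysis.

Set Implicit Arguments.
Unset Strict Implicit.
Unset Printing Implicit Defensive.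

Import Order.TTheory GRing.Theory Num.Theory.
Import numFieldNormedType.Exports.

Local Open Scope classical_set_scope.
Local Open Scope ring_scope.
Local Open Scope ereal_scope.

HB.mixin Record isTopologicalGroup G & Topological G & Group G := {
  mulg_continuous : continuous (fun x : G * G => (x.1 * x.2)%g) ;
  invg_continuous : continuous (fun x : G => (x^-1)%g)
}.

#[short(type="topologicalGroupType")]
HB.structure Definition TopologicalGroup :=
  {G of Topological G & Group G & isTopologicalGroup G}.

Definition metrizable (R : realType) (T : topologicalType) : Prop :=
  exists dist : T -> T -> R,
    [/\ forall x y, dist x y = 0%R <-> x = y,
        forall x y, dist x y = dist y x,
        forall x y z, (dist x z <= dist x y + dist y z)%R &
        forall x, nbhs x = filter_from [set e : R | (0 < e)%R]
                             (fun e => [set y | (dist x y < e)%R])].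

(* A copy of G carrying its Borel sigma-algebra. Measurable types are pointed;
   the chosen point is the unit of G. *)
Definition borel (G : topologicalGroupType) : Type := G.

HB.instance Definition _ (G : topologicalGroupType) :=
  TopologicalGroup.on (borel G).
HB.instance Definition _ (G : topologicalGroupType) :=
  isPointed.Build (borel G) (1%g : G).
HB.instance Definition _ (G : topologicalGroupType) :=
  Measurable.copy (borel G) (g_sigma_algebraType (@open (borel G))).

Section measures_on_groups.
Context (R : realType) (G : topologicalGroupType).

(* On a compact group a left-invariant probability is also right-invariant, and
   on a metrizable one every Borel probability is regular. *)
Definition normalized_haar (mu : probability (borel G) R) : Prop :=
  forall (g : G) (A : set (borel G)), measurable A ->
    mu ((fun x => (g * x)%g) @^-1` A) = mu A.

(* In a second countable space this intersection has itself full measure, so it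
   is the smallest closed set of full measure. *)
Definition support (nu : probability (borel G) R) : set G :=
  \bigcap_(F in [set F : set (borel G) | closed F /\ nu F = 1]) F.

Definition adapted (nu : probability (borel G) R) : Prop :=
  forall H : set G, closed H -> group_closed [pred x in H] -> H != setT ->
    ~ (support nu `<=` H).

(* Convolution is a bare set function, since the multiplication of G need not be
   measurable for the product of the Borel sigma-algebras when G is not second
   countable. *)
Definition convolution (m1 m2 : set (borel G) -> \bar R) :
    set (borel G) -> \bar R :=
  pushforward (m1 \x m2) (fun z : borel G * borel G => (z.1 * z.2)%g : borel G).

Definition convolution_power (nu : set (borel G) -> \bar R) (k : nat) :
    set (borel G) -> \bar R :=
  iter k (convolution nu) \d_(1%g : borel G).

End measures_on_groups.

Definition mutually_singular d (T : measurableType d) (R : realType)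
    (m1 m2 : set T -> \bar R) : Prop :=
  exists N, [/\ measurable N, m1 (~` N) = 0 & m2 N = 0].

Definition lebesgue_decomposition d (T : measurableType d) (R : realType)
    (m mu : set T -> \bar R) (m_abs m_sing : {measure set T -> \bar R}) : Prop :=
  [/\ forall A, measurable A -> m A = m_abs A + m_sing A,
      m_abs `<< mu & mutually_singular m_sing mu].

Section iid_sequences.
Context d d' (Omega : measurableType d) (T : measurableType d') (R : realType).
Context (P : probability Omega R).

Definition mutually_independent (X : nat -> {RV P >-> T}) : Prop :=
  forall (J : {fset nat}) (A : nat -> set T), (forall i, measurable (A i)) ->
    P (\bigcap_(i in [set` J]) (X i @^-1` A i)) =
    \prod_(i <- J) P (X i @^-1` A i).

Definition iid (X : nat -> {RV P >-> T}) (nu : probability T R) : Prop :=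
  mutually_independent X /\
  forall i A, measurable A -> distribution P (X i) A = nu A.

End iid_sequences.

(* The sequence is indexed from 0: X i is the (i + 1)-st variable, so that
   random_walk X k is the product, in this order, of the first k variables. *)
Definition random_walk (G : topologicalGroupType) d (Omega : measurableType d)
    (R : realType) (P : probability Omega R)
    (X : nat -> {RV P >-> borel G}) (k : nat) (w : Omega) : borel G :=
  (\prod_(0 <= i < k) X i w)%g.

(* Main.v *)
(* Write L f x = \int f (x y) dnu(y) for the transition operator of the walk.

   (i) => (iii).  If nu^{*k} has an absolutely continuous part, it dominates
   e mu on some A with mu A > 0, so nu^{*2k} dominates
   e^2 mu (A \cap z A^-1) mu(dz), whose density is bounded below near some z by
   continuity of translation in measure.  The set of points near which some
   nu^{*n} dominates a multiple of mu is open and stable under the left action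
   of the support of nu; the elements stabilising it form a closed submonoid,
   hence a closed subgroup, so adaptedness makes it all of G.  By compactness a
   finite average of convolution powers dominates c mu (Doeblin), so it contracts
   mean-zero functions and the Poisson equation f - mu f = g - L g has a bounded
   solution g.  Up to a bounded error the centred sums of f are then a martingale
   with bounded increments; an exponential supermartingale stopped at a level
   bounds its maximum over blocks of length 2^j, and Borel-Cantelli concludes.

   (ii) => (i).  A Borel set that the walk almost surely never leaves has Haar
   measure 1 by (ii).  Apply this to a closed subgroup containing the support, or
   to a null set carrying all the convolution powers if these are all singular. *)
Require Import Defs.
From HB Require Import structures.
From mathcomp Require Import all_boot all_order all_algebra.
From mathcomp Require Import finmap.
From mathcomp Require Import all_classical all_reals all_analysis.
From mathcomp Require Import measurable_realfun.
From mathcomp Require Import ring lra.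

Set Implicit Arguments.
Unset Strict Implicit.
Unset Printing Implicit Defensive.

Import Order.TTheory GRing.Theory Num.Theory.
Import numFieldNormedType.Exports.

Local Open Scope classical_set_scope.
Local Open Scope ring_scope.

(** * Topology of compact metrizable groups *)

(** One power of [nu] need not dominate a multiple of [mu]: if all steps lie in one nontrivial coset
    of an open normal subgroup, each power stays in a single coset. The contraction therefore
    concerns an average of powers of L, not L itself. The Poisson equation is first solved for this
    average by a Neumann series, and telescoping h - L^n h turns that solution into one for L; the
    powers of L need not converge. Only the finiteness of the limsup is at stake, so crude constants
    suffice: increments scaled to at most 1/2, a quadratic bound on exp, dyadic blocks. Conditional
    expectations are replaced by the product form of the joint law of the present state and the next
    variable. This is proved for any recursively driven chain, so it serves both the walk and its
    stopped exponential process. Measurability of the multiplication, hence Tonelli for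
    convolutions, comes from a countable basis, which a compact metrizable space has. Finally (iii)
    gives (ii) because sqrt(N log log N) is o(N). *)

Definition open_basis (T : topologicalType) (U : nat -> set T) : Prop :=
  (forall i, open (U i)) /\
  (forall x O, nbhs x O -> exists2 i, U i x & U i `<=` O).

Lemma metrizable_nbhs_seq (R : realType) (T : topologicalType) (x : T) :
  metrizable R T -> exists V : nat -> set T,
    (forall n, nbhs x (V n)) /\
    (forall O, nbhs x O -> exists n, forall m, (n <= m)%N -> V m `<=` O).
Proof.
move=> [dist [_ _ _ nb]]; exists (fun n => [set y | dist x y < n.+1%:R^-1]).
split=> [n|O]; rewrite nb.
  by exists n.+1%:R^-1 => //=; rewrite invr_gt0.
case=> e /= e0 eO; have [n ne] : exists n, n.+1%:R^-1 < e.
  have [n _ nP] := near_infty_natSinv_lt (PosNum e0).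
  by exists n; exact: nP (leqnn n).
exists n => m nm y /= xy; apply: eO; apply: lt_trans xy _.
by apply: le_lt_trans ne; rewrite lef_pV2 ?posrE// ler_nat.
Qed.

Lemma compact_metrizable_basis (R : realType) (T : ptopologicalType) :
  compact [set: T] -> metrizable R T -> exists U, @open_basis T U.
Proof.
move=> cT [dist [d0 dC dD nb]].
pose B (n : nat) (x : T) := [set y | dist x y < n.+1%:R^-1].
have BB n x : nbhs x (B n x) by rewrite nb; exists n.+1%:R^-1 => //=; rewrite invr_gt0.
have oB n x : open (B n x).
  rewrite openE => y /= xy; rewrite /interior nb.
  exists (n.+1%:R^-1 - dist x y); first by rewrite /= subr_gt0.
  move=> z /=; rewrite ltrBrDl; exact: le_lt_trans.
have fin n : exists s : seq T, forall y, exists2 x, x \in s & B n x y.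
  have : cover_compact [set: T] by rewrite -compact_cover.
  move=> /(_ T setT (B n) (fun x _ => oB n x)).
  case=> [y _|D _ DT]; first by exists y => //; exact: nbhs_singleton.
  exists (enum_fset D) => y.
  by have [x xD xy] := DT y I; exists x.
have [s sP] := choice fin.
(* The index k codes a radius 1/(n+1) and a position in the finite net [s n]; numbers that code
   nothing give the empty set, which is open. *)
pose U k := if choice.unpickle k is Some (n, i) then B n (nth point (s n) i) else set0.
exists U; split=> [k|x O].
  by rewrite /U; case: (choice.unpickle k) => [[n i]|]; [exact: oB|exact: open0].
rewrite nb => -[e /= e0 eO].
have [n _ /(_ n (leqnn n)) /= ne] := near_infty_natSinv_lt (PosNum (divr_gt0 e0 (ltr0n R 2))).
have [y ys xy] := sP n x.
exists (choice.pickle (n, index y (s n))); rewrite /U choice.pickleK nth_index// => z yz.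
apply: eO => /=; apply: le_lt_trans (dD _ y _) _.
rewrite [e]splitr ltrD//; last exact: lt_trans yz ne.
by rewrite dC; apply: lt_trans xy ne.
Qed.

Lemma cvgMg (G : topologicalGroupType) T (F : set_system T) (f g : T -> G)
    (a b : G) : Filter F ->
  f x @[x --> F] --> a -> g x @[x --> F] --> b ->
  (f x * g x)%g @[x --> F] --> (a * b)%g.
Proof.
move=> FF fa gb.
apply: (@cvg_comp _ _ _ (fun x => (f x, g x)) (fun z => (z.1 * z.2)%g) F
  (nbhs (a, b))).
  exact: cvg_pair fa gb.
exact: (@mulg_continuous G (a, b)).
Qed.

Lemma cvgVg (G : topologicalGroupType) T (F : set_system T) (f : T -> G)
    (a : G) : Filter F ->
  f x @[x --> F] --> a -> (f x)^-1%g @[x --> F] --> a^-1%g.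
Proof.
move=> FF fa; apply: (@cvg_comp _ _ _ f (fun z => z^-1%g) F (nbhs a)) => //.
exact: (@invg_continuous G a).
Qed.

(* If x ^ n and x ^ m are both close to a cluster point of the powers of x, with
   n < m, then x ^ (m - n - 1) is close to x^-1. *)
Lemma closed_submonoid_group (G : topologicalGroupType) (H : set G) :
  compact [set: G] -> closed H -> H 1%g ->
  (forall x y, H x -> H y -> H (x * y)%g) -> group_closed [pred x in H].
Proof.
move=> cG clH H1 HM.
have HX x n : H x -> H (x ^+ n)%g.
  by move=> Hx; elim: n => [|n IH]; rewrite ?expg0// expgS; exact: HM.
have HV x : H x -> H (x^-1)%g.
  move=> Hx; rewrite (closure_id H).1//.
  have [p [_ pP]] : [set: G] `&` cluster ((fun n => (x ^+ n)%g) @ \oo) !=set0.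
    exact: (cG ((fun n : nat => (x ^+ n)%g : G) @ \oo) _ filterT).
  move=> W xW.
  pose F (ab : G * G) := (ab.1^-1 * ab.2 * x^-1)%g.
  have cF : F x0 @[x0 --> (p, p)] --> F (p, p).
    apply: cvgMg; last exact: cvg_cst.
    apply: cvgMg; last exact: cvg_snd.
    by apply: cvgVg; exact: cvg_fst.
  have /cF : nbhs (F (p, p)) W by rewrite /F /= mulVg mul1g.
  case=> -[A B] /= [Ap Bp] ABW.
  have pV : nbhs p (A `&` B) by exact: filterI.
  have inf n : exists2 m, (n < m)%N & (A `&` B) (x ^+ m)%g.
    have [|y [[m nm <-] ym]] := pP [set (x ^+ m)%g | m in [set m | (n < m)%N]] _ _ pV.
      by exists n.+1 => // m /= nm; exists m.
    by exists m.
  have [n _ [An _]] := inf 0%N; have [m nm [_ Bm]] := inf n.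
  exists (F ((x ^+ n)%g, (x ^+ m)%g)); split; last exact: ABW.
  rewrite /F /=; have -> : m = (n + (m - n).-1.+1)%N.
    by rewrite prednK ?subn_gt0// subnKC// ltnW.
  by rewrite expgnDr mulKg expgSr mulgK; exact: HX.
split=> [|x y]; rewrite !inE// => Hx Hy.
by apply: HM => //; exact: HV.
Qed.

(** * Convolution of Borel probabilities *)

Lemma measurable_preimageT d d' (T : measurableType d) (T' : measurableType d')
    (f : T -> T') S :
  measurable_fun setT f -> measurable S -> measurable (f @^-1` S).
Proof. by move=> mf mS; rewrite -[X in measurable X]setTI; exact: mf. Qed.

Definition mulB (G : topologicalGroupType) (z : borel G * borel G) : borel G :=
  (z.1 * z.2)%g.

Lemma open_measurable_borel (G : topologicalGroupType) (O : set (borel G)) :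
  open O -> measurable O.
Proof. exact: sub_sigma_algebra. Qed.

Lemma closed_measurable_borel (G : topologicalGroupType) (F : set (borel G)) :
  closed F -> measurable F.
Proof.
by move=> /closed_openC/open_measurable_borel/measurableC; rewrite setCK.
Qed.

Lemma continuous_measurable_borel (G : topologicalGroupType)
    (f : borel G -> borel G) : continuous f -> measurable_fun setT f.
Proof.
move=> /continuousP cf; apply: (@measurability _ _ _ _ _ f (@open (borel G))) => //.
by move=> _ [W oW <-]; rewrite setTI; apply: open_measurable_borel; exact: cf.
Qed.

Lemma measurable_lmul (G : topologicalGroupType) (x : G) :
  measurable_fun setT (fun y : borel G => (x * y)%g : borel G).
Proof.
apply: continuous_measurable_borel => y.
by apply: (@cvgMg G); [exact: cvg_cst|exact: cvg_id].
Qed.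

Lemma measurable_rmul (G : topologicalGroupType) (x : G) :
  measurable_fun setT (fun y : borel G => (y * x)%g : borel G).
Proof.
apply: continuous_measurable_borel => y.
by apply: (@cvgMg G); [exact: cvg_id|exact: cvg_cst].
Qed.

Lemma measurable_invB (G : topologicalGroupType) :
  measurable_fun setT (fun y : borel G => y^-1%g : borel G).
Proof. exact: (continuous_measurable_borel (@invg_continuous G)). Qed.

(** A countable basis makes every open subset of the square a countable union of open rectangles,
    hence measurable for the product of the Borel sigma-algebras. *)
Lemma measurable_mulB (G : topologicalGroupType) (U : nat -> set (borel G)) :
  open_basis U -> measurable_fun setT (@mulB G).
Proof.
move=> [oU UP]; apply: (@measurability _ _ _ _ _ _ (@open (borel G))) => //.
move=> _ [W oW <-]; rewrite setTI.
(* Placing the inclusion inside the set makes [F ij] either the rectangle or empty, so the union may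
   run over all pairs. *)
pose F (ij : nat * nat) : set (borel G * borel G) :=
  [set z | (U ij.1 `*` U ij.2) z /\ U ij.1 `*` U ij.2 `<=` @mulB G @^-1` W].
have -> : @mulB G @^-1` W = \bigcup_ij F ij.
  apply/seteqP; split => [[x y] xyW|z [ij _ [zU]]]; last by apply.
  have : nbhs (x, y) (@mulB G @^-1` W).
    by apply: (@mulg_continuous G (x, y)); exact: open_nbhs_nbhs.
  case=> -[A B] /= [Ax By] ABW.
  have [i xi iA] := UP _ _ Ax; have [j yj jB] := UP _ _ By.
  exists (i, j) => //; split=> // -[a b] [/= /iA Aa /jB Bb].
  by apply: ABW.
apply: countable_bigcupT_measurable => //.
move=> [i j]; rewrite /F/=.
have [UO|nUO] := pselect (U i `*` U j `<=` @mulB G @^-1` W).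
  rewrite [X in measurable X](_ : _ = U i `*` U j).
    by apply: measurableX; exact: open_measurable_borel.
  by apply/seteqP; split => z //= -[].
by rewrite [X in measurable X](_ : _ = set0)// -subset0 => z [].
Qed.

Section convolution_measure.
Context (R : realType) (G : topologicalGroupType).
Hypothesis mM : measurable_fun setT (@mulB G).
Local Open Scope ereal_scope.

Definition mulB_mfun : {mfun (borel G * borel G)%type >-> borel G} :=
  mfun_Sub (mem_set mM).

Definition gconv (m1 m2 : probability (borel G) R) : probability (borel G) R :=
  distribution (m1 \x m2) mulB_mfun.

Definition gconvn (nu : probability (borel G) R) (k : nat) :
    probability (borel G) R := iter k (gconv nu) \d_(1%g : borel G).

Lemma preimage_lmul_measurable (x : G) (S : set (borel G)) :
  measurable S -> measurable ((fun y : borel G => x * y)%g @^-1` S).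
Proof. by move=> mS; rewrite -[X in measurable X]setTI; exact: measurable_lmul. Qed.

Lemma gconvE (m1 m2 : probability (borel G) R) S :
  gconv m1 m2 S = \int[m1]_x m2 ((fun y => x * y)%g @^-1` S).
Proof.
rewrite /gconv /distribution /= /pushforward /product_measure1.
apply: eq_integral => x _ /=; congr (m2 _).
by apply/seteqP; split => y /=; rewrite /xsection/= inE.
Qed.

(** Bridge to the bare set functions of the theorem; the equality is one of functions on all sets,
    measurable or not. *)
Lemma gconvnE nu k : (gconvn nu k : set (borel G) -> \bar R) = convolution_power nu k.
Proof. by elim: k => //= k IH; rewrite /gconvn /= /convolution -IH. Qed.

Lemma ge0_integral_gconv (m1 m2 : probability (borel G) R) (f : borel G -> \bar R) :
  measurable_fun setT f -> (forall x, 0 <= f x) ->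
  \int[gconv m1 m2]_x f x = \int[m1]_x \int[m2]_y f (x * y)%g.
Proof.
move=> mf f0; rewrite ge0_integral_distribution//.
by rewrite fubini_tonelli1//=; exact: (measurableT_comp mf mM).
Qed.

Lemma measurable_conv_kernel (m : probability (borel G) R) S : measurable S ->
  measurable_fun setT (fun x : borel G => m ((fun y => x * y)%g @^-1` S)).
Proof.
move=> mS; rewrite [X in measurable_fun _ X](_ : _ = m \o xsection (@mulB G @^-1` S)).
  apply: measurable_fun_xsection.
  by rewrite -[X in measurable X]setTI; exact: mM.
apply/funext => x /=; congr (m _).
by apply/seteqP; split => y /=; rewrite /xsection/= inE.
Qed.

Lemma gconvA (m1 m2 m3 : probability (borel G) R) S : measurable S ->
  gconv (gconv m1 m2) m3 S = gconv m1 (gconv m2 m3) S.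
Proof.
move=> mS; rewrite gconvE ge0_integral_gconv//; last exact: measurable_conv_kernel.
rewrite gconvE; apply: eq_integral => x _; rewrite gconvE; apply: eq_integral => y _.
by congr (m3 _); apply/seteqP; split => z /=; rewrite mulgA.
Qed.

Lemma eq_gconv (m1 m2 m1' m2' : probability (borel G) R) S : measurable S ->
  (forall S, measurable S -> m1 S = m1' S) ->
  (forall S, measurable S -> m2 S = m2' S) -> gconv m1 m2 S = gconv m1' m2' S.
Proof.
move=> mS E1 E2; rewrite !gconvE (eq_measure_integral m1')//.
  by apply: eq_integral => x _; apply: E2; exact: preimage_lmul_measurable.
by move=> A mA _; exact: E1.
Qed.

Lemma gconvnD nu m n S : measurable S ->
  gconvn nu (m + n) S = gconv (gconvn nu m) (gconvn nu n) S.
Proof.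
elim: m S => [|m IH] S mS.
  rewrite gconvE integral_dirac//=; last exact: measurable_conv_kernel.
  rewrite diracT mul1e; congr (gconvn nu n _).
  by apply/seteqP; split => y /=; rewrite mul1g.
transitivity (gconv nu (gconv (gconvn nu m) (gconvn nu n)) S); last first.
  by rewrite -gconvA.
by apply: (@eq_gconv nu (gconvn nu (m + n))).
Qed.

(** [gconvn] adds new factors on the left while the walk adds them on the right; this form drives
    the induction of [random_walk_law]. *)
Lemma gconvnSr nu n S : measurable S ->
  gconvn nu n.+1 S = gconv (gconvn nu n) nu S.
Proof.
move=> mS; rewrite -addn1 gconvnD//; apply: eq_gconv => // A mA.
rewrite -[LHS]/(gconv nu (gconvn nu 0) A) gconvE.
under eq_integral do rewrite /gconvn/= diracE.
transitivity (\int[nu]_x (\1_A x)%:E); last by rewrite integral_indic// setIT.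
apply: eq_integral => x _; rewrite indicE; congr ((nat_of_bool _)%:R%:E).
by apply/idP/idP; rewrite !inE/= mulg1.
Qed.

End convolution_measure.

(** * Haar measure *)

Section haar.
Context (R : realType) (G : topologicalGroupType).
Variables (mu : probability (borel G) R) (mu_haar : normalized_haar mu).
Hypothesis mM : measurable_fun setT (@mulB G).
Local Open Scope ereal_scope.

(* Integrate 1_A (x^-1 y) over x and y in both orders. *)
Lemma haar_invg (A : set (borel G)) : measurable A ->
  mu ((fun x => x^-1)%g @^-1` A) = mu A.
Proof.
move=> mA.
have mg : measurable_fun setT
    (fun z : borel G * borel G => (z.1^-1%g : borel G, z.2)).
  apply: measurable_fun_pair; last exact: measurable_snd.
  exact: (measurableT_comp (@measurable_invB G) measurable_fst).
have mF : measurable_fun setT (fun z : borel G * borel G => (z.1^-1 * z.2)%g : borel G).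
  exact: (measurableT_comp mM mg).
pose f (z : borel G * borel G) : \bar R := (\1_A (z.1^-1 * z.2)%g)%:E.
have mf : measurable_fun setT f.
  by apply/measurable_EFinP; exact: (measurableT_comp (measurable_indic mA) mF).
have f0 z : 0 <= f z by rewrite /f lee_fin.
have fubini : \int[mu]_x fubini_F mu f x = \int[mu]_y fubini_G mu f y.
  exact: fubini_tonelli.
have ind B : measurable B -> \int[mu]_x (\1_B x)%:E = mu B.
  by move=> mB; rewrite integral_indic// setIT.
have mV : measurable ((fun x => x^-1)%g @^-1` A : set (borel G)).
  by rewrite -[X in measurable X]setTI; exact: measurable_invB.
have FE x : fubini_F mu f x = mu A.
  rewrite /fubini_F /f /=.
  rewrite (_ : (fun y => _) = (fun y : borel G => (\1_((fun y => x^-1 * y)%g @^-1` A) y)%:E)).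
    by rewrite ind ?mu_haar//; exact: preimage_lmul_measurable.
  by apply/funext => y; rewrite !indicE; congr ((nat_of_bool _)%:R%:E);
    apply/idP/idP; rewrite !inE.
have GE y : fubini_G mu f y = mu ((fun x => x^-1)%g @^-1` A).
  rewrite /fubini_G /f /=.
  rewrite (_ : (fun x => _) = (fun x : borel G =>
     (\1_((fun x => y^-1 * x)%g @^-1` ((fun x => x^-1)%g @^-1` A)) x)%:E)).
    by rewrite ind ?mu_haar//; exact: preimage_lmul_measurable.
  by apply/funext => x; rewrite !indicE; congr ((nat_of_bool _)%:R%:E);
    apply/idP/idP; rewrite !inE/= invgM invgK.
move: fubini; rewrite (eq_integral (cst (mu A))); last by move=> x _; exact: FE.
rewrite [RHS](eq_integral (cst (mu ((fun x => x^-1)%g @^-1` A)))); last first.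
  by move=> y _; exact: GE.
rewrite !integral_cst//.
have muT : (mu : {measure set (borel G) -> \bar R}) setT = 1 by exact: probability_setT.
by rewrite muT !mule1.
Qed.

(** Right translation by g is left translation by g^-1 conjugated by inversion. *)
Lemma haar_right (g : G) (A : set (borel G)) : measurable A ->
  mu ((fun x => x * g)%g @^-1` A) = mu A.
Proof.
move=> mA; have mV : measurable ((fun x => x^-1)%g @^-1` A : set (borel G)).
  by rewrite -[X in measurable X]setTI; exact: measurable_invB.
rewrite -haar_invg; last first.
  by rewrite -[X in measurable X]setTI; exact: measurable_rmul.
rewrite -[RHS](haar_invg mA) -(mu_haar g^-1%g mV); congr (mu _).
by apply/seteqP; split => x /=; rewrite invgM invgK.
Qed.

Definition trans (w : G) (B : set (borel G)) : set (borel G) :=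
  (fun x => w^-1 * x)%g @^-1` B.

Lemma measurable_trans w B : measurable B -> measurable (trans w B).
Proof. exact: preimage_lmul_measurable. Qed.

Lemma haar_trans w B : measurable B -> mu (trans w B) = mu B.
Proof. exact: mu_haar. Qed.

Lemma haar_setD_trans w B : measurable B ->
  mu (trans w B `\` B) = mu (B `\` trans w B).
Proof.
move=> mB; have mT := measurable_trans w mB.
have fin C : measurable C -> mu C < +oo by move=> mC; rewrite ltey_eq fin_num_measure.
by rewrite !measureD ?fin// setIC; congr (_ - _); exact: haar_trans.
Qed.

(** Measurability is part of the definition so that this class can be shown to be a sigma-algebra
    containing the open sets. The one-sided difference is enough, since [haar_setD_trans] gives the
    other one the same measure. *)
Definition translation_continuous (B : set (borel G)) : Prop :=
  measurable B /\ forall e : R, (0 < e)%R ->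
    \forall w \near (1%g : G), mu (B `\` trans w B) < e%:E.

Lemma translation_continuousC B :
  translation_continuous B -> translation_continuous (~` B).
Proof.
move=> [mB cB]; split=> [|e e0]; first exact: measurableC.
apply: filterS (cB e e0) => w; rewrite -haar_setD_trans//.
by rewrite !setDE setCK setIC.
Qed.

Lemma translation_continuousU A B :
  translation_continuous A -> translation_continuous B ->
  translation_continuous (A `|` B).
Proof.
move=> [mA cA] [mB cB]; split=> [|e e0]; first exact: measurableU.
have e20 : (0 < e / 2)%R by rewrite divr_gt0.
near=> w; rewrite (splitr e) EFinD.
apply: (@le_lt_trans _ _ (mu (A `\` trans w A) + mu (B `\` trans w B))).
  have mDA : measurable (A `\` trans w A).
    by apply: measurableD => //; exact: measurable_trans.
  have mDB : measurable (B `\` trans w B).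
    by apply: measurableD => //; exact: measurable_trans.
  apply: le_trans (measureU2 _ mDA mDB); apply: le_measure; rewrite ?inE.
  - apply: measurableD; first exact: measurableU.
    by apply: measurable_trans; exact: measurableU.
  - exact: measurableU.
  - by move=> x [[Ax|Bx] nx]; [left|right]; split=> // tx; apply: nx; [left|right].
by apply: lteD; near: w; [exact: cA|exact: cB].
Unshelve. all: by end_near. Qed.

(** By continuity from above a finite union [F n] misses at most e/2 of the whole union. A point
    lost by the translation lies outside [F n] or is already lost from [F n]. *)
Lemma translation_continuous_bigcup (B : (set (borel G))^nat) :
  (forall n, translation_continuous (B n)) ->
  translation_continuous (\bigcup_n B n).
Proof.
move=> tB; have mB n : measurable (B n) := (tB n).1.
have mU : measurable (\bigcup_n B n) by exact: bigcupT_measurable.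
split=> // e e0; have e20 : (0 < e / 2)%R by rewrite divr_gt0.
pose F n := \big[setU/set0]_(i < n) B i.
have tF n : translation_continuous (F n).
  rewrite /F; elim: n => [|n IH]; last first.
    by rewrite big_ord_recr/=; exact: translation_continuousU.
  by rewrite big_ord0; split=> // e' e'0; apply: nearW => w; rewrite set0D measure0.
have mF n : measurable (F n) := (tF n).1.
have mD n : measurable (\bigcup_n B n `\` F n) by exact: measurableD.
have cap0 : \bigcap_n (\bigcup_n B n `\` F n) = set0.
  rewrite -subset0 => x xF; have [[n _ Bx] _] := xF 0%N I.
  have [_ /=] := xF n.+1 I; apply; rewrite /F -bigcup_mkord.
  by exists n => /=.
have : mu (\bigcup_n B n `\` F n) @[n --> \oo] --> 0.
  rewrite -(measure0 mu) -cap0; apply: nonincreasing_cvg_mu => //.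
  - by rewrite ltey_eq fin_num_measure.
  - by rewrite cap0.
  - move=> m n mn; apply/subsetPset => x [Ux nx]; split=> // Fx; apply: nx.
    move: Fx; rewrite /F -!bigcup_mkord => -[k /= km Bk].
    by exists k => //=; exact: leq_trans mn.
move=> /fine_cvgP [_] /cvgr0_norm_lt/(_ _ e20) [n _ /(_ n (leqnn n))] /= Dn.
have {}Dn : mu (\bigcup_n B n `\` F n) < (e / 2)%:E.
  rewrite -[ltLHS]fineK ?fin_num_measure// lte_fin.
  by apply: le_lt_trans Dn; exact: ler_norm.
near=> w; rewrite (splitr e) EFinD.
have mDF : measurable (F n `\` trans w (F n)).
  by apply: measurableD => //; exact: measurable_trans.
apply: (@le_lt_trans _ _ (mu (\bigcup_n B n `\` F n) + mu (F n `\` trans w (F n)))).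
  apply: le_trans (measureU2 _ (mD n) mDF); apply: le_measure; rewrite ?inE.
  - by apply: measurableD => //; exact: measurable_trans.
  - exact: measurableU.
  - move=> x [Ux nx]; have [Fx|] := pselect (F n x); last by left.
    right; split => // tx; apply: nx; move: tx; rewrite /trans /= /F -bigcup_mkord.
    by case=> k _ Bk; exists k.
by apply: lteD => //; near: w; apply: (tF n).2.
Unshelve. all: by end_near. Qed.

(** Otherwise some w_n tending to 1 have mu (O \ w_n O) >= e. The limsup of these sets is empty,
    because a point of the open set O eventually lies in w_n O; yet its measure is the limit of the
    measures of the tail unions, each at least e. Metrizability supplies the sequence. *)
Lemma translation_continuous_open (O : set (borel G)) :
  metrizable R G -> open O -> translation_continuous O.
Proof.
move=> metG oO; have mO : measurable O by exact: open_measurable_borel.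
split=> // e e0; apply: contrapT => nnear.
have [V [V1 VP]] := metrizable_nbhs_seq (1%g : G) metG.
have /choice[w wP] n : exists w, V n w /\ e%:E <= mu (O `\` trans w O).
  apply: contrapT => nw; apply: nnear; apply: filterS (V1 n) => w Vw.
  by rewrite ltNge; apply/negP => ew; apply: nw; exists w.
pose F n := O `\` trans (w n) O.
have mF n : measurable (F n) by apply: measurableD => //; exact: measurable_trans.
have F0 : lim_sup_set F = set0.
  rewrite -subset0 => x Fx; have [_ _ [Ox _]] := Fx 0%N I.
  have : nbhs (1%g : G) [set v | O (v^-1 * x)%g].
    have : (v^-1 * x)%g @[v --> (1%g : G)] --> (1^-1 * x : G)%g.
      by apply: (@cvgMg G); [apply: cvgVg; exact: cvg_id|exact: cvg_cst].
    by apply; apply: open_nbhs_nbhs; split=> //; rewrite invg1 mul1g.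
  move=> /VP[n Vn]; have [m /= nm [_]] := Fx n I; apply.
  exact: (Vn m nm (w m) (wP m).1).
have : e%:E <= mu (lim_sup_set F).
  apply: cvge_to_ge (lim_sup_set_cvg mu F mF _) _.
    by rewrite ltey_eq fin_num_measure//; exact: bigcup_measurable.
  apply: nearW => n; apply: le_trans (wP n).2 _; apply: le_measure; rewrite ?inE//.
  - exact: mF.
  - by apply: bigcup_measurable => k _; exact: mF.
  - by move=> x Fx; exists n => /=.
by rewrite F0 measure0 leNgt lte_fin e0.
Qed.

Lemma haar_translation_continuous (B : set (borel G)) :
  metrizable R G -> measurable B -> translation_continuous B.
Proof.
move=> metG; apply: smallest_sub => [|A oA]; last exact: translation_continuous_open.
split=> [|A tA|A tA].
- by split=> // e e0; apply: nearW => w; rewrite set0D measure0.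
- by rewrite setTD; exact: translation_continuousC.
- exact: translation_continuous_bigcup.
Qed.

End haar.

(** * Minorization and the Doeblin condition *)

(** A density of at least c on V, expressed without choosing a density. *)
Definition minorizes d (T : measurableType d) (R : realType)
    (m mu : set T -> \bar R) (c : R) (V : set T) : Prop :=
  [/\ 0 < c, measurable V &
     forall S, measurable S -> (c%:E * mu (S `&` V) <= m S)%E].

Lemma minorizes_integral d (T : measurableType d) (R : realType)
    (m mu : {measure set T -> \bar R}) c V (h : T -> \bar R) :
  minorizes m mu c V -> measurable_fun setT h -> (forall x, 0 <= h x)%E ->
  (c%:E * \int[mu]_(x in V) h x <= \int[m]_x h x)%E.
Proof.
move=> [c0 mV cV] mh h0.
have mhV : measurable_fun V h by exact: measurable_funTS.
pose r : {nonneg R} := NngNum (ltW c0).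
have -> : (c%:E * \int[mu]_(x in V) h x = \int[mscale r mu]_(x in V) h x)%E.
  by rewrite ge0_integral_mscale.
rewrite [leLHS](eq_measure_integral (mscale r (mrestr mu mV))); last first.
  by move=> S mS SV; rewrite /= /mscale/= /mrestr setIidl.
apply: (@le_trans _ _ (\int[mscale r (mrestr mu mV)]_x h x)%E).
  by apply: ge0_subset_integral.
by apply: ge0_le_measure_integral => // S mS; exact: cV.
Qed.

(** For some n the Radon-Nikodym density is at least 1/(n+1) on a set of positive measure; otherwise
    it would vanish almost everywhere and force m A = 0. *)
Lemma abs_cont_minorizes d (T : measurableType d) (R : realType)
    (mu : probability T R) (m : {measure set T -> \bar R}) (A : set T) :
  (m setT < +oo)%E -> m `<< mu -> measurable A -> m A <> 0%E ->
  exists c V, (0 < mu V)%E /\ minorizes m mu c V.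
Proof.
move=> mfin mmu mA mA0.
(* Restricting to the whole space changes no value; it only packages [m] as a finite measure. *)
pose fm := mfrestr measurableT mfin.
have fmE S : fm S = m S by rewrite /fm /mfrestr /mrestr setIT.
have fmmu : fm `<< mu.
  by move=> S muS B mB BS; rewrite fmE; exact: (mmu _ muS).
have [f [f0 /integrableP[mf _] fE]] := @radon_nikodym_finite _ _ _ mu fm fmmu.
have mE S : measurable S -> (m S = \int[mu]_(x in S) f x)%E.
  by move=> mS; rewrite -fmE; exact: fE.
pose V (n : nat) := [set x | (n.+1%:R^-1)%:E <= f x]%E.
have mV n : measurable (V n).
  by rewrite /V -[X in measurable X]setTI; exact: emeasurable_fun_c_infty.
have [[n Vn]|nV] := pselect (exists n, 0 < mu (V n))%E.
  exists n.+1%:R^-1, (V n); split => //; split => // S mS.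
  have mSV : measurable (S `&` V n) by exact: measurableI.
  apply: (@le_trans _ _ (m (S `&` V n))); last first.
    by apply: le_measure; rewrite ?inE//; exact: subIsetl.
  rewrite mE// -integral_cst//; apply: ge0_le_integral => //.
  - by move=> x _; rewrite lee_fin.
  - exact: measurable_funTS.
  - by move=> x [].
exfalso; apply: mA0; apply/eqP; rewrite eq_le measure_ge0 andbT.
have mU : measurable (\bigcup_n V n) by exact: bigcupT_measurable.
have mU0 : m (\bigcup_n V n) = 0%E.
  apply: (null_content_dominatesP m mu).1 => //.
  apply: measure_negligible => //; apply: negligible_bigcup => n.
  apply/negligibleP => //; apply/eqP; rewrite eq_le measure_ge0 andbT leNgt.
  by apply/negP => Vn; apply: nV; exists n.
have mD : measurable (A `\` \bigcup_n V n) by exact: measurableD.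
apply: (@le_trans _ _ (m (\bigcup_n V n) + m (A `\` \bigcup_n V n))%E).
  apply: le_trans (measureU2 _ mU mD); apply: le_measure; rewrite ?inE//.
    exact: measurableU.
  by move=> x Ax; have [|] := pselect ((\bigcup_n V n) x); [left|right].
rewrite mU0 add0e mE// integral0_eq// => x [_ nVx].
apply/eqP; rewrite eq_le f0 andbT leNgt; apply/negP => fx0; apply: nVx.
case E : (f x) (f0 x) fx0 => [r| |]//=; last first.
  by move=> _ _; exists 0%N => //; rewrite /V/= E leey.
rewrite lte_fin => _ r0.
have [n _ /(_ n (leqnn n)) /= nr] := near_infty_natSinv_lt (PosNum r0).
by exists n => //; rewrite /V/= E lee_fin ltW.
Qed.

Lemma integral_xsection_ysection d1 d2 (T1 : measurableType d1)
    (T2 : measurableType d2) (R : realType)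
    (m1 : {sigma_finite_measure set T1 -> \bar R})
    (m2 : {sigma_finite_measure set T2 -> \bar R}) (Q : set (T1 * T2)) :
  measurable Q ->
  (\int[m1]_x m2 (xsection Q x) = \int[m2]_y m1 (ysection Q y))%E.
Proof.
move=> mQ.
transitivity (\int[m1]_x fubini_F m2 (EFin \o \1_Q) x)%E.
  by apply: eq_integral => x _; rewrite indic_fubini_tonelli_FE.
rewrite indic_fubini_tonelli//; apply: eq_integral => y _.
by rewrite indic_fubini_tonelli_GE.
Qed.

Section doeblin.
Context (R : realType) (G : topologicalGroupType).
Hypothesis mM : measurable_fun setT (@mulB G).
Hypothesis metG : metrizable R G.
Variables (mu : probability (borel G) R) (mu_haar : normalized_haar mu).
Local Open Scope ereal_scope.

(* [mu (overlap A z)] is the density at z of the convolution square of mu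
   restricted to A. *)
Definition overlap (A : set (borel G)) (z : G) : set (borel G) :=
  A `&` [set x | A (x^-1 * z)%g].

Lemma measurable_overlap_set (A S : set (borel G)) : measurable A -> measurable S ->
  measurable ([set xz | A xz.1 /\ S xz.2 /\ A (xz.1^-1 * xz.2)%g]
    : set (borel G * borel G)).
Proof.
move=> mA mS.
have mg : measurable_fun setT
    (fun z : borel G * borel G => (z.1^-1%g : borel G, z.2)).
  apply: measurable_fun_pair; last exact: measurable_snd.
  exact: (measurableT_comp (@measurable_invB G) measurable_fst).
have mF : measurable_fun setT (fun z : borel G * borel G => (z.1^-1 * z.2)%g : borel G).
  exact: (measurableT_comp mM mg).
apply: (@measurableI _ _ (fst @^-1` A)); first exact: measurable_preimageT measurable_fst mA.
apply: measurableI; first exact: measurable_preimageT measurable_snd mS.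
exact: measurable_preimageT mF mA.
Qed.

(** Both sides are the product measure of the set [Q], sliced along its first and its second
    coordinate. *)
Lemma overlap_fubini (A S : set (borel G)) : measurable A -> measurable S ->
  \int[mu]_(x in A) mu (S `&` trans x A) = \int[mu]_(z in S) mu (overlap A z).
Proof.
move=> mA mS.
pose Q := [set xz | A xz.1 /\ S xz.2 /\ A (xz.1^-1 * xz.2)%g] : set (borel G * borel G).
have mQ : measurable Q by exact: measurable_overlap_set.
have E := @integral_xsection_ysection _ _ _ _ R mu mu Q mQ.
rewrite integral_mkcond [RHS]integral_mkcond.
transitivity (\int[mu]_x mu (xsection Q x)).
  apply: eq_integral => x _; rewrite patchE /=; case: ifPn => [|] xA.
    congr (mu _); apply/seteqP; split=> y; rewrite /xsection/= inE /Q/=.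
      by move=> [Sy Ay]; split=> //; rewrite inE in xA.
    by case.
  rewrite (_ : xsection Q x = set0) ?measure0//.
  rewrite -subset0 => y; rewrite /xsection/= inE => -[/= Ax _].
  by move: xA; rewrite notin_setE.
rewrite E; apply: eq_integral => z _; rewrite patchE /=; case: ifPn => [|] zS.
  congr (mu _); apply/seteqP; split=> x; rewrite /ysection/= inE /Q/=.
    by move=> [Ax [_ Ay]]; split.
  by move=> [Ax Ay]; split=> //; split => //; rewrite inE in zS.
rewrite (_ : ysection Q z = set0) ?measure0//.
rewrite -subset0 => y; rewrite /ysection/= inE => -[/= _ [Sz _]].
by move: zS; rewrite notin_setE.
Qed.

Lemma measurable_overlap (A : set (borel G)) z : measurable A -> measurable (overlap A z).
Proof.
move=> mA; apply: measurableI => //.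
have mf : measurable_fun setT (fun x : borel G => (x^-1 * z)%g : borel G).
  exact: (measurableT_comp (@measurable_rmul G z) (@measurable_invB G)).
exact: measurable_preimageT mf mA.
Qed.

(** By [overlap_fubini] the overlaps integrate to (mu A)^2 > 0, so one of them, B at z0, has
    positive measure. With w = z z0^-1, every x in B and in w B lies in the overlap at z, because
    (w^-1 x)^-1 z0 = x^-1 z. Near z0 the translate w B loses less than half of B, hence e = mu B /
    2. *)
Lemma overlap_lower_bound (A : set (borel G)) : measurable A -> 0 < mu A ->
  exists (e : R) (z0 : G), (0 < e)%R /\
    \forall z \near z0, e%:E <= mu (overlap A z).
Proof.
move=> mA A0.
have [z0 z0P] : exists z0, 0 < mu (overlap A z0).
  apply: contrapT => nz.
  have : \int[mu]_(x in A) mu (setT `&` trans x A) = 0.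
    rewrite overlap_fubini// integral0_eq// => z _.
    apply/eqP; rewrite eq_le measure_ge0 andbT leNgt; apply/negP => z0.
    by apply: nz; exists z.
  under eq_integral do rewrite setTI haar_trans//.
  rewrite integral_cst// => /eqP; rewrite mule_eq0 => /orP[] /eqP A00.
    by rewrite A00 ltxx in A0.
  by move: A0; rewrite A00 ltxx.
set B := overlap A z0 in z0P.
have mB : measurable B by exact: measurable_overlap.
have finB C : measurable C -> mu C \is a fin_num by move=> mC; exact: fin_num_measure.
pose e := (fine (mu B) / 2)%R.
have e0 : (0 < e)%R by rewrite divr_gt0// fine_gt0// z0P/= ltey_eq finB.
exists e, z0; split => //.
have [_ /(_ e e0) cB] := haar_translation_continuous mu_haar metG mB.
have cz : (z * z0^-1)%g @[z --> z0] --> (1%g : G).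
  by rewrite -(mulgV z0); apply: (@cvgMg G); [exact: cvg_id|exact: cvg_cst].
apply: (@filterS _ (nbhs z0) _ _ _ _ (cz _ cB)) => z /= Bz.
have mT := measurable_trans (z * z0^-1)%g mB.
apply: (@le_trans _ _ (mu (B `&` trans (z * z0^-1)%g B))); last first.
  apply: le_measure; rewrite ?inE.
  - exact: measurableI.
  - by apply: measurable_overlap.
  - move=> x [[Ax _] [_ /= Axz]]; split => //=.
    suff <- : (((z * z0^-1)^-1 * x)^-1 * z0 = x^-1 * z)%g by [].
    by rewrite invgM invgK -!mulgA mulVg mulg1.
have mD : measurable (B `\` trans (z * z0^-1)%g B) by exact: measurableD.
have mI : measurable (B `&` trans (z * z0^-1)%g B) by exact: measurableI.
have : mu B = mu (B `\` trans (z * z0^-1)%g B) + mu (B `&` trans (z * z0^-1)%g B).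
  exact: measureDI.
move: Bz; rewrite /e.
move: (finB _ mB) (finB _ mD) (finB _ mI).
case: (mu B) => [b| |]//; case: (mu (_ `\` _)) => [x| |]//.
case: (mu (_ `&` _)) => [y| |]// _ _ _ /=.
by rewrite lte_fin lee_fin => + [bxy]; rewrite bxy; lra.
Qed.

End doeblin.

Section doeblin.
Context (R : realType) (G : topologicalGroupType).
Hypothesis mM : measurable_fun setT (@mulB G).
Hypothesis metG : metrizable R G.
Variables (mu : probability (borel G) R) (mu_haar : normalized_haar mu).
Local Open Scope ereal_scope.

Let pre_lmulE (x : G) (S A : set (borel G)) : measurable S -> measurable A ->
  mu ((fun y => x * y)%g @^-1` S `&` A) = mu (S `&` trans x A).
Proof.
move=> mS mA; rewrite -[LHS](mu_haar x^-1%g); last first.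
  by apply: measurableI => //; exact: preimage_lmul_measurable.
by congr (mu _); apply/seteqP; split=> y /=; rewrite mulVKg.
Qed.

Let measurable_mu_trans S A : measurable S -> measurable A ->
  measurable_fun setT (fun x : borel G => mu (S `&` trans x A)).
Proof.
move=> mS mA.
pose Q : set (borel G * borel G) := @mulB G @^-1` S `&` snd @^-1` A.
have mQ : measurable Q.
  apply: measurableI; rewrite -[X in measurable X]setTI; first exact: mM.
  exact: measurable_snd.
rewrite (_ : (fun x => _) = mu \o xsection Q); first exact: measurable_fun_xsection.
apply/funext => x; rewrite /= -pre_lmulE//; congr (mu _).
by apply/seteqP; split => y; rewrite /xsection/= inE.
Qed.

Let measurable_mu_overlap (A : set (borel G)) : measurable A ->
  measurable_fun setT (fun z : borel G => mu (overlap A z)).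
Proof.
move=> mA; have mQ := measurable_overlap_set mM mA measurableT.
set Q := (X in measurable X) in mQ.
rewrite (_ : (fun x => _) = mu \o ysection Q); first exact: measurable_fun_ysection.
apply/funext => x /=; congr (mu _).
by apply/seteqP; split => y; rewrite /ysection/= inE => -[? //] => -[].
Qed.

Lemma conv_minorizes (m : probability (borel G) R) (e : R) (A : set (borel G)) :
  minorizes m mu e A -> 0 < mu A ->
  exists (c : R) (x : G) (V : set (borel G)),
    [/\ open V, V x & minorizes (gconv mM m m) mu c V].
Proof.
move=> [e0 mA eA] A0.
have [d [z0 [d0 dz]]] := overlap_lower_bound mM metG mu_haar mA A0.
(* Each of the two factors of the convolution contributes one e, and d bounds the overlaps from
   below; the interior makes the set open. *)
exists (e * (e * d))%R, z0, (interior [set z | d%:E <= mu (overlap A z)]); split => //.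
  exact: open_interior.
have mV : measurable (interior [set z | d%:E <= mu (overlap A z)] : set (borel G)).
  by apply: open_measurable_borel; exact: open_interior.
split => // [|S mS]; first by rewrite !mulr_gt0.
set V := interior _ in mV *.
rewrite gconvE.
apply: (@le_trans _ _ (e%:E * \int[mu]_(x in A) m ((fun y => x * y)%g @^-1` S))); last first.
  apply: minorizes_integral => //; exact: measurable_conv_kernel.
rewrite EFinM -muleA lee_pmul2l//.
have mtr := measurable_mu_trans mS mA.
have mov := measurable_mu_overlap mA.
apply: (@le_trans _ _ (\int[mu]_(x in A) (e%:E * mu (S `&` trans x A)))).
  rewrite ge0_integralZl//; last 2 first.
  - exact: measurable_funTS.
  - by rewrite lee_fin ltW.
  rewrite EFinM -muleA lee_pmul2l// overlap_fubini//.
  have mSV : measurable (S `&` V) by exact: measurableI.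
  rewrite -integral_cst//.
  apply: (@le_trans _ _ (\int[mu]_(z in S `&` V) mu (overlap A z))).
    apply: ge0_le_integral => //.
    - by move=> z _; rewrite lee_fin ltW.
    - exact: measurable_funTS.
    - by move=> z [_ /interior_subset].
  by apply: ge0_subset_integral => //; exact: measurable_funTS.
apply: ge0_le_integral => //.
- by move=> x _; rewrite mule_ge0// lee_fin ltW.
- by apply: measurable_funTS; exact: measurable_funeM.
- by apply: measurable_funTS; exact: measurable_conv_kernel.
- move=> x _; rewrite -pre_lmulE//; apply: eA.
  exact: preimage_lmul_measurable.
Qed.

(** By continuity of (y, z) -> y^-1 z at (s, s x) there are neighbourhoods W of s and V' of s x with
    y^-1 V' inside V for y in W. Each such first step y carries the minorization of m on V to one on
    y V, which contains V'. These steps have positive probability since s is in the support. *)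
Lemma conv_minorizes_translate (nu m : probability (borel G) R) (c : R)
    (V : set (borel G)) (s x : G) :
  Defs.support nu s -> open V -> V x -> minorizes m mu c V ->
  exists (c' : R) (V' : set (borel G)),
    [/\ open V', V' (s * x)%g & minorizes (gconv mM nu m) mu c' V'].
Proof.
move=> sup_s oV Vx [c0 mV cV].
pose F (yz : G * G) := (yz.1^-1 * yz.2)%g.
have : F yz @[yz --> (s, (s * x)%g)] --> F (s, (s * x)%g).
  by apply: cvgMg; [apply: cvgVg; exact: cvg_fst|exact: cvg_snd].
have FV : nbhs (F (s, (s * x)%g)) V.
  by rewrite /F /= mulKg; exact: open_nbhs_nbhs.
move=> /(_ _ FV) [[W V'] /= [Ws V's] WV'].
pose W' : set (borel G) := interior W.
have mW' : measurable W' by apply: open_measurable_borel; exact: open_interior.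
have nuW : 0 < nu W'.
  rewrite lt0e measure_ge0 andbT; apply/eqP => nuW0.
  have := sup_s (~` W'); apply => //; split; first exact/open_closedC/open_interior.
  by rewrite probability_setC// nuW0 sube0.
have fW : nu W' \is a fin_num by exact: fin_num_measure.
exists (c * fine (nu W'))%R, (interior V'); split => //.
  exact: open_interior.
have mV' : measurable (interior V' : set (borel G)).
  by apply: open_measurable_borel; exact: open_interior.
split => // [|S mS]; first by rewrite mulr_gt0// fine_gt0// nuW/= ltey_eq fW.
rewrite gconvE.
apply: (@le_trans _ _ (\int[nu]_(y in W') m ((fun z => y * z)%g @^-1` S))); last first.
  apply: ge0_subset_integral => //; exact: measurable_conv_kernel.
rewrite EFinM fineK// muleAC -integral_cst//.
apply: ge0_le_integral => //.
- by move=> y _; rewrite mule_ge0// lee_fin ltW.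
- by apply: measurable_funTS; exact: measurable_conv_kernel.
- move=> y W'y; apply: le_trans (cV _ (preimage_lmul_measurable y mS)).
  rewrite lee_pmul2l// pre_lmulE//; apply: le_measure; rewrite ?inE.
  + exact: measurableI.
  + by apply: measurableI => //; exact: measurable_trans.
  + move=> z [Sz V'z]; split => //; apply: (WV' (y, z)); split => /=.
      exact: interior_subset.
    exact: interior_subset.
Qed.

End doeblin.

Section doeblin.
Context (R : realType) (G : topologicalGroupType).
Hypothesis mM : measurable_fun setT (@mulB G).
Hypothesis metG : metrizable R G.
Variables (mu : probability (borel G) R) (mu_haar : normalized_haar mu).
Variable nu : probability (borel G) R.

Lemma minorizes_eq (m m' : set (borel G) -> \bar R) (c : R) V :
  (forall S, measurable S -> m S = m' S) -> minorizes m mu c V -> minorizes m' mu c V.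
Proof. by move=> E [c0 mV cV]; split=> // S mS; rewrite -E//; exact: cV. Qed.

Definition minorized_near (x : G) : Prop :=
  exists (n : nat) (c : R) (V : set (borel G)),
    [/\ open V, V x & minorizes (gconvn mM nu n) mu c V].

Lemma minorized_nearT : compact [set: G] -> adapted nu ->
  (exists x, minorized_near x) -> forall x, minorized_near x.
Proof.
move=> G_compact ad [x0 x0P] y.
pose E := [set x | minorized_near x].
have oE : open E.
  rewrite openE => x [n [c [V [oV Vx mV]]]].
  apply: (@filterS _ (nbhs x) _ V); last exact: open_nbhs_nbhs.
  by move=> z Vz; exists n, c, V.
(* This is the set of g with g E inside E, phrased on the complement of E: it then is an
   intersection of closed sets, one for each x outside E. *)
pose H := [set g : G | forall x, ~ E x -> ~ E (g^-1 * x)%g].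
have clH : closed H.
  rewrite (_ : H = \bigcap_(x in ~` E) ~` [set g | E (g^-1 * x)%g]); last first.
    by apply/seteqP; split => g Hg x; exact: Hg.
  apply: closed_bigI => x _; apply: open_closedC.
  rewrite openE => g Eg.
  have : (g0^-1 * x)%g @[g0 --> g] --> (g^-1 * x)%g.
    by apply: cvgMg; [apply: cvgVg; exact: cvg_id|exact: cvg_cst].
  by apply; exact: open_nbhs_nbhs.
have H1 : H 1%g by move=> x nEx; rewrite invg1 mul1g.
have HM g h : H g -> H h -> H (g * h)%g.
  by move=> Hg Hh x nEx; rewrite invgM -mulgA; apply: Hh; exact: Hg.
have HT : H = setT.
  apply: contrapT => /eqP nT; apply: (ad H) => //.
    exact: closed_submonoid_group.
  move=> s sup_s x nEx [n [c [V [oV Vsx mV]]]]; apply: nEx.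
  have [c' [V' [oV' V'x mV']]] := conv_minorizes_translate mM mu_haar sup_s oV Vsx mV.
  by exists n.+1, c', V'; rewrite mulVKg in V'x; split.
apply: contrapT => nEy.
(* This element carries [x0] to y. *)
have : H (y * x0^-1)%g by rewrite HT.
by move=> /(_ y nEy); rewrite invgM invgK -mulgA mulVg mulg1.
Qed.

Lemma minorized_near_of_abs_cont (k : nat) :
  (exists m_abs m_sing : {measure set (borel G) -> \bar R},
    lebesgue_decomposition (convolution_power nu k) mu m_abs m_sing /\
    exists2 A, measurable A & m_abs A <> 0%E) ->
  exists x, minorized_near x.
Proof.
move=> [m_abs [m_sing [[dec absc _] [A mA A0]]]].
have fin : (m_abs setT < +oo)%E.
  apply: (@le_lt_trans _ _ 1%E); last exact: ltry.
  rewrite -(@probability_setT _ _ _ (gconvn mM nu k)).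
  rewrite -[leRHS]/((gconvn mM nu k : set (borel G) -> \bar R) setT) gconvnE.
  by rewrite dec// leeDl.
have [c [V [V0 [c0 mV cV]]]] := abs_cont_minorizes fin absc mA A0.
have mn : minorizes (gconvn mM nu k) mu c V.
  split=> // S mS; apply: le_trans (cV S mS) _.
  rewrite -[leRHS]/((gconvn mM nu k : set (borel G) -> \bar R) S) gconvnE.
  by rewrite dec// leeDl.
have [c' [x [V' [oV' V'x mV']]]] := conv_minorizes mM metG mu_haar mn V0.
exists x, (k + k)%N, c', V'; split => //.
by apply: minorizes_eq mV' => S mS; rewrite -gconvnD.
Qed.

(** Different points may need different powers, so the finite subcover yields a sum of powers
    instead of one power. *)
Lemma doeblin (G_compact : compact [set: G]) :
  (forall x, minorized_near x) ->
  exists (s : seq nat) (c : R), 0 < c /\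
    forall S, measurable S ->
      (c%:E * mu S <= \sum_(n <- s) gconvn mM nu n S)%E.
Proof.
move=> near.
have [n_ nP] := choice near; have [c_ cP] := choice nP; have [V_ VP] := choice cP.
have : cover_compact [set: borel G] by rewrite -compact_cover.
move=> /(_ _ setT V_ (fun x _ => let: And3 o _ _ := VP x in o)).
case=> [x _|D _ DT]; first by exists x => //; have [] := VP x.
have mV x : measurable (V_ x) by apply: open_measurable_borel; have [] := VP x.
(* Induction over the subcover by subadditivity of [mu]: each new set brings its own summand, so [s]
   may repeat a power, and c becomes the minimum of the constants. *)
suff [c [c0 cl]] : exists c : R, 0 < c /\ forall S, measurable S ->
    (c%:E * mu (S `&` \big[setU/set0]_(x <- enum_fset D) V_ x) <=
      \sum_(n <- map n_ (enum_fset D)) gconvn mM nu n S)%E.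
  exists (map n_ (enum_fset D)), c; split=> // S mS.
  apply: le_trans (cl S mS); rewrite (_ : _ `&` _ = S)//.
  apply/seteqP; split=> [x []//|x Sx]; split=> //.
  have [y yD Vyx] := DT x I.
  by rewrite -bigcup_seq; exists y.
elim: (enum_fset D) => [|x l [c [c0 IH]]].
  by exists 1; split=> // S mS; rewrite !big_nil setI0 measure0 mule0.
have [_ _ [cx0 _ cxV]] := VP x.
exists (Num.min (c_ x) c); split=> [|S mS]; first by rewrite lt_min cx0.
rewrite /= !big_cons.
have mB : measurable (\big[setU/set0]_(y <- l) V_ y) by exact: bigsetU_measurable.
have m0 : 0 <= Num.min (c_ x) c by rewrite le_min !ltW.
apply: (@le_trans _ _ ((Num.min (c_ x) c)%:E * mu (S `&` V_ x) +
   (Num.min (c_ x) c)%:E * mu (S `&` \big[setU/set0]_(y <- l) V_ y)))%E.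
  rewrite -muleDr//; last first.
    by apply: ge0_adde_def; rewrite inE.
  apply: lee_wpmul2l; first by rewrite lee_fin.
  rewrite setIUr; apply: measureU2; exact: measurableI.
apply: leeD.
  apply: le_trans (cxV S mS); apply: lee_wpmul2r => //.
  by rewrite lee_fin ge_min lexx.
apply: le_trans (IH S mS); apply: lee_wpmul2r => //.
by rewrite lee_fin ge_min lexx orbT.
Qed.

End doeblin.

(** * Bounded measurable functions *)

(** The bound K is kept explicit because the contraction estimates and the Neumann series are
    expressed through it. *)
Definition bddmf d (T : measurableType d) (R : realType) (K : R) (f : T -> R) :=
  measurable_fun setT f /\ forall x, `|f x| <= K.

Section bounded_measurable.
Context d (T : measurableType d) (R : realType).
Implicit Types (K : R) (f g : T -> R) (P : probability T R).

Lemma bddmf_integrable P K f : bddmf K f -> P.-integrable setT (EFin \o f).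
Proof.
move=> [mf fK]; apply: measurable_bounded_integrable => //.
  by rewrite ltey_eq fin_num_measure.
exists K; split; first exact: num_real.
by move=> x Kx y _; apply: le_trans (fK y) _; exact: ltW.
Qed.

Lemma EFin_Rintegral P K f : bddmf K f ->
  (\int[P]_x f x)%:E = (\int[P]_x (f x)%:E)%E.
Proof.
move=> fK; rewrite /Rintegral fineK//; apply: integrable_fin_num => //.
exact: (@bddmf_integrable P K).
Qed.

Lemma bddmf_cst (k : R) : bddmf `|k| (cst k : T -> R).
Proof. by split. Qed.

Lemma bddmfD K K' f g : bddmf K f -> bddmf K' g -> bddmf (K + K') (fun x => f x + g x).
Proof.
move=> [mf fK] [mg gK]; split=> [|x]; first exact: measurable_funD.
by apply: le_trans (ler_normD _ _) _; exact: lerD.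
Qed.

Lemma bddmfZ K f a : bddmf K f -> bddmf (`|a| * K) (fun x => a * f x).
Proof.
move=> [mf fK]; split=> [|x]; first exact: measurable_funM.
by rewrite normrM ler_wpM2l.
Qed.

Lemma bddmfB K K' f g : bddmf K f -> bddmf K' g -> bddmf (K + K') (fun x => f x - g x).
Proof.
move=> [mf fK] [mg gK]; split=> [|x]; first exact: measurable_funB.
by apply: le_trans (ler_normB _ _) _; exact: lerD.
Qed.

Lemma bddmf_sum (I : Type) (s : seq I) (K : I -> R) (f : I -> T -> R) :
  (forall i, bddmf (K i) (f i)) ->
  bddmf (\sum_(i <- s) K i) (fun x => \sum_(i <- s) f i x).
Proof.
move=> fK; split=> [|x]; first by apply: measurable_sum => i; have [] := fK i.
by apply: le_trans (ler_norm_sum _ _ _) _; apply: ler_sum => i _; have [] := fK i.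
Qed.

Lemma Rintegral_cstP P (k : R) : \int[P]_x (cst k x) = k.
Proof.
rewrite Rintegral_cst// [X in fine X](_ : _ = 1%E) ?mulr1//.
exact: probability_setT.
Qed.

Lemma Rintegral_norm_le P K f : bddmf K f -> `|\int[P]_x f x| <= K.
Proof.
move=> fK; have If := bddmf_integrable P fK.
have K0 : 0 <= K by have [_ /(_ point)] := fK; exact: le_trans.
apply: le_trans (le_normr_Rintegral _ _) _ => //.
rewrite -[leRHS](Rintegral_cstP P); apply: le_Rintegral => //.
- by apply: (@bddmf_integrable _ `|K|); split=> [|x];
    [exact: measurableT_comp fK.1|rewrite normr_id (ger0_norm K0); exact: fK.2].
- exact: bddmf_integrable (bddmf_cst K).
- by move=> x _; exact: fK.2.
Qed.

Lemma RintegralDP P K K' f g : bddmf K f -> bddmf K' g ->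
  \int[P]_x (f x + g x) = \int[P]_x f x + \int[P]_x g x.
Proof.
by move=> fK gK; apply: RintegralD => //; [exact: bddmf_integrable fK|exact: bddmf_integrable gK].
Qed.

Lemma RintegralBP P K K' f g : bddmf K f -> bddmf K' g ->
  \int[P]_x (f x - g x) = \int[P]_x f x - \int[P]_x g x.
Proof.
by move=> fK gK; apply: RintegralB => //; [exact: bddmf_integrable fK|exact: bddmf_integrable gK].
Qed.

Lemma RintegralZP P K f a : bddmf K f ->
  \int[P]_x (a * f x) = a * \int[P]_x f x.
Proof. by move=> fK; apply: RintegralZl => //; exact: bddmf_integrable fK. Qed.

Lemma Rintegral_sumP P (I : Type) (s : seq I) (K : I -> R) (f : I -> T -> R) :
  (forall i, bddmf (K i) (f i)) ->
  \int[P]_x (\sum_(i <- s) f i x) = \sum_(i <- s) \int[P]_x f i x.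
Proof.
move=> fK; elim: s => [|i s IH].
  by under eq_Rintegral do rewrite big_nil; rewrite big_nil (Rintegral_cstP P 0).
under eq_Rintegral do rewrite big_cons.
by rewrite big_cons -IH (RintegralDP P (fK i) (bddmf_sum s fK)).
Qed.

End bounded_measurable.

Lemma bddmf_comp d d' (T : measurableType d) (T' : measurableType d') (R : realType)
    (K : R) (f : T' -> R) (g : T -> T') :
  bddmf K f -> measurable_fun setT g -> bddmf K (fun x => f (g x)).
Proof. by move=> [mf fK] mg; split=> [|x //]; exact: measurableT_comp mf mg. Qed.

Section parametric.
Context d1 d2 (T1 : measurableType d1) (T2 : measurableType d2) (R : realType).
Variables (P : probability T2 R) (K : R) (F : T1 * T2 -> R).
Hypothesis FK : bddmf K F.

Lemma bddmf_section x : bddmf K (fun y => F (x, y)).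
Proof. by apply: (bddmf_comp (g := pair x) FK); exact: pair1_measurable. Qed.

(** Adding K makes the integrand nonnegative, which brings Tonelli's theorem and its measurability
    statement within reach of signed functions. *)
Lemma EFin_Rintegral_shift x :
  (\int[P]_y (F (x, y) + K)%:E = (\int[P]_y F (x, y) + K)%:E)%E.
Proof.
have Fx := bddmf_section x.
rewrite -(EFin_Rintegral P (bddmfD Fx (bddmf_cst T2 K))); congr (_%:E).
by rewrite (RintegralDP P Fx (bddmf_cst T2 K)) (Rintegral_cstP P K).
Qed.

Lemma bddmf_parametric : bddmf K (fun x => \int[P]_y F (x, y)).
Proof.
split=> [|x]; last exact: Rintegral_norm_le (bddmf_section x).
rewrite (_ : (fun x => _) = (fun x => (\int[P]_y F (x, y) + K) - K)); last first.
  by apply/funext => x; rewrite addrK.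
apply: measurable_funB => //; apply/measurable_EFinP.
rewrite (_ : _ \o _ = fubini_F P (fun z => (F z + K)%:E)); last first.
  by apply/funext => x; rewrite /fubini_F EFin_Rintegral_shift.
apply: measurable_fun_fubini_tonelli_F => [|z].
  by apply/measurable_EFinP; apply: measurable_funD => //; exact: FK.1.
by rewrite lee_fin -lerBlDr sub0r; have := FK.2 z; rewrite ler_norml => /andP[].
Qed.

End parametric.

(** * The transition operator and the Poisson equation *)

Section transop_operator.
Context (R : realType) (G : topologicalGroupType).
Hypothesis mM : measurable_fun setT (@mulB G).
Variables (mu : probability (borel G) R) (mu_haar : normalized_haar mu).
Variable nu : probability (borel G) R.
Implicit Types (K : R) (f g : borel G -> R).

Definition transop (f : borel G -> R) (x : borel G) : R := \int[nu]_y f (x * y)%g.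

Lemma bddmf_lmul K f (x : borel G) : bddmf K f -> bddmf K (fun y : borel G => f (x * y)%g).
Proof.
move=> fK; apply: (bddmf_comp (g := fun y : borel G => (x * y)%g : borel G) fK).
exact: measurable_lmul.
Qed.

Lemma bddmf_mulB K f : bddmf K f ->
  bddmf K (fun z : borel G * borel G => f (z.1 * z.2)%g).
Proof. by move=> fK; exact: (bddmf_comp (g := @mulB G) fK). Qed.

Lemma Rintegral_gconv (m1 m2 : probability (borel G) R) K f : bddmf K f ->
  \int[gconv mM m1 m2]_x f x = \int[m1]_x \int[m2]_y f (x * y)%g.
Proof.
move=> fK; have FK := bddmf_mulB fK.
have f0 x : (0 <= (f x + K)%:E)%E.
  by rewrite lee_fin -lerBlDr sub0r; have := fK.2 x; rewrite ler_norml => /andP[].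
have mf : measurable_fun setT (fun x : borel G => (f x + K)%:E).
  by apply/measurable_EFinP; apply: measurable_funD => //; exact: fK.1.
have cK := bddmf_cst (borel G) K.
have pK := bddmf_parametric m2 FK.
(* The nonnegative function f + K is integrated; K survives both integrations unchanged and cancels
   at the end. *)
have := ge0_integral_gconv mM m1 m2 mf f0.
rewrite -(EFin_Rintegral _ (bddmfD fK cK)) (RintegralDP _ fK cK) (Rintegral_cstP _ K).
under eq_integral do rewrite (EFin_Rintegral_shift m2 FK).
rewrite -(EFin_Rintegral _ (bddmfD pK cK)) (RintegralDP _ pK cK) (Rintegral_cstP _ K).
by move=> [] /(congr1 (fun t => t - K)); rewrite !addrK.
Qed.

Lemma bddmf_transop K f : bddmf K f -> bddmf K (transop f).
Proof. by move=> fK; exact: (bddmf_parametric nu (bddmf_mulB fK)). Qed.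

Lemma bddmf_iter_transop K f n : bddmf K f -> bddmf K (iter n transop f).
Proof. by move=> fK; elim: n => //= n IH; exact: bddmf_transop. Qed.

Lemma transop_gconvn K f n x : bddmf K f ->
  \int[gconvn mM nu n]_y f (x * y)%g = iter n transop f x.
Proof.
move=> fK; elim: n x => [|n IH] x.
  rewrite /gconvn /= /Rintegral integral_dirac//; last first.
    by apply/measurable_EFinP; exact: (bddmf_lmul x fK).1.
  by rewrite diracT mul1e /= mulg1.
rewrite (@Rintegral_gconv nu (gconvn mM nu n) K _ (bddmf_lmul x fK)) /= /transop.
by apply: eq_Rintegral => y _; rewrite -IH; apply: eq_Rintegral => z _; rewrite /= mulgA.
Qed.

Lemma transopD K K' f g : bddmf K f -> bddmf K' g ->
  transop (fun x => f x + g x) = (fun x => transop f x + transop g x).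
Proof.
move=> fK gK; apply/funext => x; rewrite /transop.
exact: RintegralDP (bddmf_lmul x fK) (bddmf_lmul x gK).
Qed.

Lemma transopB K K' f g : bddmf K f -> bddmf K' g ->
  transop (fun x => f x - g x) = (fun x => transop f x - transop g x).
Proof.
move=> fK gK; apply/funext => x; rewrite /transop.
exact: RintegralBP (bddmf_lmul x fK) (bddmf_lmul x gK).
Qed.

Lemma transopZ K f a : bddmf K f ->
  transop (fun x => a * f x) = (fun x => a * transop f x).
Proof.
move=> fK; apply/funext => x; rewrite /transop.
exact: RintegralZP (bddmf_lmul x fK).
Qed.

Lemma transop_sum (I : Type) (s : seq I) (K : I -> R) (f : I -> borel G -> R) :
  (forall i, bddmf (K i) (f i)) ->
  transop (fun x => \sum_(i <- s) f i x) = (fun x => \sum_(i <- s) transop (f i) x).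
Proof.
move=> fK; apply/funext => x; rewrite /transop.
exact: Rintegral_sumP (fun i => bddmf_lmul x (fK i)).
Qed.

Lemma haar_lmul K f x : bddmf K f -> \int[mu]_y f (x * y)%g = \int[mu]_y f y.
Proof.
move=> fK.
have mh := (bddmf_parametric mu (bddmf_mulB fK)).1.
transitivity (\int[gconv mM \d_x mu]_y f y).
  rewrite (Rintegral_gconv _ _ fK) [RHS]/Rintegral integral_dirac//.
    by rewrite diracT mul1e.
  exact/measurable_EFinP.
rewrite /Rintegral; congr fine; apply: eq_measure_integral => S mS _.
transitivity (gconv mM \d_x mu S) => //.
rewrite gconvE integral_dirac//=; last exact: measurable_conv_kernel.
by rewrite diracT mul1e; exact: mu_haar.
Qed.

(** The walk multiplies on the right, so stationarity of [mu] is right invariance, visible once the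
    order of integration is exchanged. *)
Lemma haar_gconv (m : probability (borel G) R) S : measurable S ->
  gconv mM mu m S = mu S.
Proof.
move=> mS; rewrite gconvE.
have mQ : measurable (@mulB G @^-1` S) by rewrite -[X in measurable X]setTI; exact: mM.
transitivity (\int[mu]_x m (xsection (@mulB G @^-1` S) x))%E.
  apply: eq_integral => x _; congr (m _).
  by apply/seteqP; split => y; rewrite /xsection/= inE.
rewrite integral_xsection_ysection// (eq_integral (cst (mu S))); last first.
  move=> y _; rewrite -(haar_right mu_haar mM y mS); congr (mu _).
  by apply/seteqP; split => x; rewrite /ysection/= inE.
rewrite integral_cst//.
have -> : (m : {measure set (borel G) -> \bar R}) setT = 1%E by exact: probability_setT.
by rewrite mule1.
Qed.

Lemma haar_transop K f : bddmf K f -> \int[mu]_x transop f x = \int[mu]_x f x.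
Proof.
move=> fK; rewrite /transop -(Rintegral_gconv mu nu fK) /Rintegral; congr fine.
by apply: eq_measure_integral => S mS _; exact: haar_gconv.
Qed.

End transop_operator.

(** The sum is packaged as the measure [msum], whose index runs over initial integers; hence the
    reindexing by [nth]. An empty list forces [mu] to vanish. *)
Lemma sum_minorizes_integral d (T : measurableType d) (R : realType)
    (I : Type) (m : I -> {measure set T -> \bar R}) (mu : {measure set T -> \bar R})
    (s : seq I) (c : R) (h : T -> \bar R) : 0 < c ->
  (forall S, measurable S -> (c%:E * mu S <= \sum_(i <- s) m i S)%E) ->
  measurable_fun setT h -> (forall x, 0 <= h x)%E ->
  (c%:E * \int[mu]_x h x <= \sum_(i <- s) \int[m i]_x h x)%E.
Proof.
move=> c0 cm mh h0; case: s cm => [|i0 s] cm.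
  have mu0 S : measurable S -> mu S = 0%E.
    move=> mS; have := cm S mS; rewrite big_nil => cS.
    apply/eqP; rewrite eq_le measure_ge0 andbT -(@pmule_rle0 _ c%:E)//.
  rewrite big_nil (eq_measure_integral mzero).
    by rewrite integral_measure_zero mule0.
  by move=> S mS _; exact: mu0.
pose r := i0 :: s; pose m_ k := m (nth i0 r k).
have E (F : I -> \bar R) : (\sum_(i <- r) F i = \sum_(k < size r) F (nth i0 r k))%E.
  by rewrite (big_nth i0) big_mkord.
have : minorizes (msum m_ (size r)) mu c setT.
  by split=> // S mS; rewrite setIT /= /msum; have := cm S mS; rewrite E.
by move=> /minorizes_integral/(_ mh h0); rewrite ge0_integral_measure_sum// E.
Qed.

(** * Contraction by the averaged operator and solution of the Poisson equation *)

Section poisson.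
Context (R : realType) (G : topologicalGroupType).
Hypothesis mM : measurable_fun setT (@mulB G).
Variables (mu : probability (borel G) R) (mu_haar : normalized_haar mu).
Variable nu : probability (borel G) R.
Variables (s : seq nat) (c : R).
Hypotheses (c0 : 0 < c)
  (cs : forall S, measurable S -> (c%:E * mu S <= \sum_(n <- s) gconvn mM nu n S)%E).
Implicit Types (K : R) (f g h : borel G -> R).
Local Notation L := (transop nu).

(** Taking S = G in [cs] shows that [s] is nonempty and, below, that [delta] is at most 1. *)
Let size_s : c <= (size s)%:R.
Proof.
have := cs measurableT.
have -> : mu setT = 1%E by exact: probability_setT.
rewrite mule1; under eq_bigr => n _.
  have -> : gconvn mM nu n setT = 1%E by exact: probability_setT.
  over.
by rewrite big_tnth sumEFin lee_fin sumr_const card_ord.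
Qed.

Let size_gt0 : 0 < (size s)%:R :> R.
Proof. exact: lt_le_trans size_s. Qed.

Let delta := c / (size s)%:R.

Let delta01 : 0 < delta <= 1.
Proof. by rewrite divr_gt0//= ler_pdivrMr// mul1r. Qed.

Definition averaged_transop f (x : borel G) : R :=
  (size s)%:R^-1 * \sum_(n <- s) iter n L f x.
Local Notation Q := averaged_transop.

(** The hypothesis [cs] concerns the walk started at the identity; left invariance of [mu] moves it
    to any starting point with the same c. *)
Lemma minorized_sum K f x : bddmf K f -> (forall y, 0 <= f y) ->
  c * \int[mu]_y f y <= \sum_(n <- s) iter n L f x.
Proof.
move=> fK f0; have fxK := bddmf_lmul x fK.
rewrite -(haar_lmul mM mu_haar x fK) -lee_fin EFinM (EFin_Rintegral mu fxK).
have mfx : measurable_fun setT (fun y : borel G => (f (x * y)%g)%:E).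
  by apply/measurable_EFinP; exact: fxK.1.
have := sum_minorizes_integral c0 cs mfx (fun y => _).
move=> /(_ (fun y => f0 (x * y)%g)) /le_trans; apply.
rewrite -sumEFin; apply: lee_sum => n _.
by rewrite -(transop_gconvn mM nu n x fK) (EFin_Rintegral _ fxK).
Qed.

Lemma transop_cstD K f k n x : bddmf K f ->
  iter n L (fun y => k + f y) x = k + iter n L f x.
Proof.
move=> fK; elim: n x => //= n IH x; rewrite (_ : iter n L _ = fun x => k + iter n L f x).
  rewrite (transopD nu (bddmf_cst _ k) (bddmf_iter_transop mM nu n fK)).
  by rewrite /transop (Rintegral_cstP nu k).
by apply/funext => y; exact: IH.
Qed.

Lemma transopN K f n x : bddmf K f ->
  iter n L (fun y => - f y) x = - iter n L f x.
Proof.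
move=> fK; elim: n x => //= n IH x; rewrite (_ : iter n L _ = fun x => -1 * iter n L f x).
  by rewrite (transopZ nu _ (bddmf_iter_transop mM nu n fK)) mulN1r.
by apply/funext => y; rewrite mulN1r; exact: IH.
Qed.

(** Apply [minorized_sum] to K + f >= 0, whose [mu]-integral is K because f has mean zero. Applied
    to -f as well, this yields the two-sided contraction. *)
Lemma averaged_transop_lower K f x : bddmf K f -> \int[mu]_y f y = 0 ->
  - ((1 - delta) * K) <= Q f x.
Proof.
move=> fK f0; have cK := bddmf_cst (borel G) K.
have Kf0 y : 0 <= K + f y.
  by rewrite -lerBlDl sub0r; have := fK.2 y; rewrite ler_norml => /andP[].
have := minorized_sum x (bddmfD cK fK) Kf0.
rewrite (RintegralDP mu cK fK) (Rintegral_cstP mu K) f0 addr0.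
under eq_bigr do rewrite (transop_cstD _ _ _ fK).
rewrite big_split/= big_tnth sumr_const card_ord /Q /delta.
have -> : - ((1 - c / (size s)%:R) * K) =
    (size s)%:R^-1 * (c * K - (size s)%:R * K).
  by field; rewrite gt_eqF.
by move=> h; rewrite ler_pM2l ?invr_gt0// lerBlDl mulr_natl.
Qed.

Lemma averaged_transop_contracts K f : bddmf K f -> \int[mu]_y f y = 0 ->
  bddmf ((1 - delta) * K) (Q f).
Proof.
move=> fK f0; split=> [|x].
  apply: measurable_funM => //; apply: measurable_sum => n.
  exact: (bddmf_iter_transop mM nu n fK).1.
rewrite ler_norml (averaged_transop_lower x fK f0)/=.
have NfK : bddmf K (fun y => - f y).
  by split=> [|y]; [exact: measurable_funN fK.1|rewrite normrN; exact: fK.2].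
have Nf0 : \int[mu]_y (- f y) = 0.
  have := RintegralZP mu (-1) fK; rewrite f0 mulr0 => <-.
  by apply: eq_Rintegral => y _; rewrite mulN1r.
have := averaged_transop_lower x NfK Nf0; rewrite lerNl /Q.
under eq_bigr do rewrite (transopN _ _ fK).
by rewrite sumrN mulrN opprK.
Qed.

Lemma haar_averaged K f : bddmf K f -> \int[mu]_x Q f x = \int[mu]_x f x.
Proof.
move=> fK; rewrite /Q (RintegralZP mu _ (bddmf_sum s (fun n => bddmf_iter_transop mM nu n fK))).
rewrite (Rintegral_sumP mu s (fun n => bddmf_iter_transop mM nu n fK)).
have E n : \int[mu]_x iter n L f x = \int[mu]_x f x.
  elim: n => //= n IH; rewrite (haar_transop mM mu_haar nu (bddmf_iter_transop mM nu n fK)).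
  exact: IH.
under eq_bigr do rewrite E.
by rewrite big_tnth sumr_const card_ord -(mulr_natl (\int[mu]_x f x)) mulKf// gt_eqF.
Qed.

Lemma iter_transop_sum (I : Type) (t : seq I) (K : I -> R) (f : I -> borel G -> R) n :
  (forall i, bddmf (K i) (f i)) ->
  iter n L (fun x => \sum_(i <- t) f i x) = (fun x => \sum_(i <- t) iter n L (f i) x).
Proof.
move=> fK; elim: n => //= n ->.
exact: (transop_sum nu t (fun i => bddmf_iter_transop mM nu n (fK i))).
Qed.

Lemma iter_transopB K K' f g n : bddmf K f -> bddmf K' g ->
  iter n L (fun x => f x - g x) = (fun x => iter n L f x - iter n L g x).
Proof.
move=> fK gK; elim: n => //= n ->.
exact: (transopB nu (bddmf_iter_transop mM nu n fK) (bddmf_iter_transop mM nu n gK)).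
Qed.

Lemma averaged_transop_sum (I : Type) (t : seq I) (K : I -> R)
    (f : I -> borel G -> R) x : (forall i, bddmf (K i) (f i)) ->
  Q (fun x => \sum_(i <- t) f i x) x = \sum_(i <- t) Q (f i) x.
Proof.
move=> fK; rewrite /Q -mulr_sumr exchange_big/=; congr (_ * _).
by apply: eq_bigr => n _; rewrite (iter_transop_sum t n fK).
Qed.

Lemma averaged_transopB K K' f g x : bddmf K f -> bddmf K' g ->
  Q (fun x => f x - g x) x = Q f x - Q g x.
Proof.
move=> fK gK; rewrite /Q -mulrBr -sumrB; congr (_ * _).
by apply: eq_bigr => n _; rewrite (iter_transopB n fK gK).
Qed.

Lemma averaged_transop_norm K f x : bddmf K f -> `|Q f x| <= K.
Proof.
move=> fK; rewrite /Q normrM ger0_norm ?invr_ge0// mulrC ler_pdivrMr//.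
apply: le_trans (ler_norm_sum _ _ _) _.
apply: le_trans (ler_sum _ (fun n _ => (bddmf_iter_transop mM nu n fK).2 x)) _.
by rewrite big_tnth sumr_const card_ord -(mulr_natr K).
Qed.

Let r := 1 - delta.

Let r01 : 0 <= r < 1.
Proof. by move: delta01 => /andP[d0 d1]; rewrite /r subr_ge0 d1/= ltrBlDr ltrDl. Qed.

Lemma iter_averaged_contracts K f j : bddmf K f -> \int[mu]_y f y = 0 ->
  bddmf (r ^+ j * K) (iter j Q f) /\ \int[mu]_y iter j Q f y = 0.
Proof.
move=> fK f0; elim: j => [|j [IHK IH0]]; first by rewrite expr0 mul1r.
rewrite exprS -mulrA iterS; split; first exact: averaged_transop_contracts.
by rewrite (haar_averaged IHK).
Qed.

(** h is the Neumann series of the iterates of [Q] on f. Its tails are uniformly at most C r^J with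
    C = K / (1 - r), and [Q] does not increase uniform bounds, so it passes to the limit. *)
Lemma averaged_resolvent K f : bddmf K f -> \int[mu]_y f y = 0 ->
  exists K' h, bddmf K' h /\ forall x, h x - Q h x = f x.
Proof.
move=> fK f0; move: r01 => /andP[r0 r1].
have r1' : 0 < 1 - r by rewrite subr_gt0.
pose u j x := iter j Q f x.
have uK j : bddmf (r ^+ j * K) (u j) := (iter_averaged_contracts j fK f0).1.
pose S J x := \sum_(0 <= j < J) u j x.
pose C := K / (1 - r).
have CK : C - C * r = K by rewrite -[X in X - _]mulr1 -mulrBr divfK// gt_eqF.
have SB J M x : (J <= M)%N -> `|S M x - S J x| <= C * (r ^+ J - r ^+ M).
  elim: M => [|M IH]; first by rewrite leqn0 => /eqP ->; rewrite !subrr normr0 mulr0.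
  rewrite leq_eqVlt => /predU1P[->|]; first by rewrite !subrr normr0 mulr0.
  rewrite ltnS => /IH {}IH; rewrite {1}/S big_nat_recr//= -/(S M x) addrAC.
  apply: le_trans (ler_normD _ _) _; apply: le_trans (lerD IH ((uK M).2 x)) _.
  have E : r ^+ M * K = C * r ^+ M - C * r * r ^+ M by rewrite -CK; ring.
  by rewrite E exprS; lra.
have C0 : 0 <= C.
  by apply: divr_ge0; [have := fK.2 point; exact: le_trans|exact: ltW].
have SC J M x : (J <= M)%N -> `|S M x - S J x| <= C * r ^+ J.
  move=> JM; apply: le_trans (SB J M x JM) _.
  by rewrite ler_wpM2l// gerBl exprn_ge0.
have cS x : cvgn (S ^~ x).
  apply: (@normed_cvg _ R^o (u ^~ x)).
  apply: (@series_le_cvg _ _ (geometric K r)).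
  - by move=> n; exact: normr_ge0.
  - by move=> n; rewrite geometric_ge0//; have := fK.2 point; exact: le_trans.
  - by move=> n /=; rewrite mulrC; exact: (uK n).2.
  - by apply: is_cvg_geometric_series; rewrite ger0_norm.
pose h x := limn (S ^~ x).
have hS J x : `|h x - S J x| <= C * r ^+ J.
  have cv : `|S M x - S J x| @[M --> \oo] --> `|h x - S J x|.
    by apply: cvg_norm; apply: cvgB; [exact: cS|exact: cvg_cst].
  apply: (closed_cvg _ (@closed_le _ (C * r ^+ J)) _ _ cv).
  by exists J => // M /= JM; exact: SC.
have SK J : bddmf (\sum_(0 <= j < J) r ^+ j * K) (S J).
  exact: (bddmf_sum (index_iota 0 J) uK).
have hK : bddmf C h.
  split=> [|x]; last by have := hS 0%N x; rewrite /S big_geq// subr0 expr0 mulr1.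
  apply: (@measurable_fun_cvg _ _ _ _ S) => [m|x _]; first exact: (SK m).1.
  exact: cS.
(* Telescoping: applying [Q] shifts the partial sum by one index, leaving only its first and last
   terms. *)
have QS J x : S J x - Q (S J) x = f x - u J x.
  rewrite (averaged_transop_sum (index_iota 0 J) x uK) /S -sumrB.
  elim: J => [|J IH]; first by rewrite big_geq// /u subrr.
  by rewrite big_nat_recr//= IH addrA subrK.
have Qdist J x : `|Q h x - Q (S J) x| <= C * r ^+ J.
  rewrite -(averaged_transopB x hK (SK J)); apply: averaged_transop_norm.
  by split=> [|y]; [exact: measurable_funB hK.1 (SK J).1|exact: hS].
exists C, h; split=> // x; apply/eqP; rewrite -subr_eq0 -normr_le0.
have bd J : `|h x - Q h x - f x| <= r ^+ J * (C + C + K).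
  have -> : h x - Q h x - f x = (h x - S J x) - (Q h x - Q (S J) x) - u J x.
    have -> : f x = S J x - Q (S J) x + u J x by rewrite QS subrK.
    by ring.
  apply: le_trans (ler_normB _ _) _.
  apply: le_trans (lerD (ler_normB _ _) ((uK J).2 x)) _.
  by have := hS J x; have := Qdist J x; lra.
have cv : r ^+ J * (C + C + K) @[J --> \oo] --> 0 * (C + C + K).
  by apply: cvgMl; apply: cvg_expr; rewrite ger0_norm.
rewrite mul0r in cv.
apply: (closed_cvg _ (@closed_ge _ `|h x - Q h x - f x|) _ _ cv).
by apply: nearW => J; exact: bd.
Qed.

(** With h from [averaged_resolvent], take for g the average over n in [s] of the sums of L^i h for
    i < n. Each sum telescopes under 1 - L to h - L^n h, so g - L g = h - Q h. *)
Lemma poisson_equation K f : bddmf K f ->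
  exists K' g, bddmf K' g /\
    forall x, g x - L g x = f x - \int[mu]_y f y.
Proof.
move=> fK; set m := \int[mu]_y f y.
have mK := bddmf_cst (borel G) m.
have fm0 : \int[mu]_y (f y - m) = 0.
  by rewrite (RintegralBP mu fK mK) (Rintegral_cstP mu m) subrr.
have [K' [h [hK hP]]] := averaged_resolvent (bddmfB fK mK) fm0.
pose T n x := \sum_(0 <= i < n) iter i L h x.
have TK n : bddmf (\sum_(0 <= i < n) K') (T n).
  exact: (bddmf_sum (index_iota 0 n) (fun i => bddmf_iter_transop mM nu i hK)).
have STK := bddmf_sum s TK.
exists (`|(size s)%:R^-1| * \sum_(n <- s) \sum_(0 <= i < n) K').
exists (fun x => (size s)%:R^-1 * \sum_(n <- s) T n x); split; first exact: bddmfZ.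
move=> x; rewrite (transopZ nu _ STK) (transop_sum nu s TK) -mulrBr -sumrB.
rewrite -hP /Q.
have -> : \sum_(n <- s) (T n x - L (T n) x) = \sum_(n <- s) (h x - iter n L h x).
  apply: eq_bigr => n _.
  rewrite (transop_sum nu (index_iota 0 n) (fun i => bddmf_iter_transop mM nu i hK)).
  rewrite /T -sumrB; elim: n => [|n IH]; first by rewrite big_geq// subrr.
  by rewrite big_nat_recr//= IH addrA subrK.
rewrite sumrB mulrBr big_tnth sumr_const card_ord.
by rewrite -(mulr_natl (h x)) mulKf// gt_eqF.
Qed.

End poisson.

(** * Recursive chains driven by i.i.d. variables *)

Section recursive_chain.
Context d d' d'' (Omega : measurableType d) (T : measurableType d')
  (Z : measurableType d'') (R : realType) (P : probability Omega R).
Variables (X : nat -> {RV P >-> T}) (nu : probability T R) (X_iid : iid X nu).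
Variables (z0 : Z) (F : Z * T -> Z).
Hypothesis mF : measurable_fun setT F.
Local Open Scope ereal_scope.

(** Instantiated twice: with [mulB] it is the random walk, with [stopped_step] the walk paired with
    its stopped exponent. The state at time n involves only the variables of index below n. *)
Fixpoint chain (n : nat) (w : Omega) : Z :=
  if n is m.+1 then F (chain m w, X m w) else z0.

Lemma measurable_chain n : measurable_fun setT (chain n).
Proof.
elim: n => [|n IH] /=; first exact: measurable_cst.
by apply: (measurableT_comp mF); apply: measurable_fun_pair.
Qed.

Let pair n (w : Omega) := (chain n w, X n w).

Let measurable_pair n : measurable_fun setT (pair n).
Proof. by apply: measurable_fun_pair => //; exact: measurable_chain. Qed.

Let chain_mfun n : {mfun Omega >-> Z} := mfun_Sub (mem_set (measurable_chain n)).
Let pair_mfun n : {mfun Omega >-> (Z * T)%type} := mfun_Sub (mem_set (measurable_pair n)).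
Let lawZ n : probability Z R := distribution P (chain_mfun n).

Let cyl (J : {fset nat}) (A : nat -> set T) := \bigcap_(i in [set` J]) (X i @^-1` A i).

Let measurable_cyl J A : (forall i, measurable (A i)) -> measurable (cyl J A).
Proof.
move=> mA; apply: bigcap_measurableType => i _.
by apply: measurable_preimageT.
Qed.

(* Quantifying over all cylinders in the coordinates from n on is what makes the
   induction on n go through. *)
Let future_independent n := forall (J : {fset nat}) (A : nat -> set T) (B : set Z),
  (forall i, i \in J -> (n <= i)%N) -> (forall i, measurable (A i)) -> measurable B ->
  P (chain n @^-1` B `&` cyl J A) = P (chain n @^-1` B) * \prod_(i <- J) nu (A i).

Let pair_law n : future_independent n ->
  forall C, measurable C -> P (pair n @^-1` C) = (lawZ n \x nu) C.
Proof.
move=> ind C mC; apply/esym.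
rewrite -[RHS]/(distribution P (pair_mfun n) C).
apply: product_measure_unique => // B A mB mA.
have := ind [fset n]%fset (fun=> A) B.
rewrite big_seq_fset1 => <- //.
  congr (P _); apply/seteqP; split=> w /=.
    by move=> [Bw Aw]; split=> // i /=; rewrite inE => /eqP ->.
  by move=> [Bw Aw]; split=> //; apply: (Aw n); rewrite /= inE.
by move=> i; rewrite inE => /eqP ->.
Qed.

(** For a fixed cylinder, the measure sending C to the probability that (chain n, X n) is in C and
    the cylinder holds agrees on rectangles, by induction, with a multiple of a product measure,
    hence everywhere. It is then evaluated at the preimage of B under [F]. *)
Lemma chain_future_independent n : future_independent n.
Proof.
have [indX lawX] := X_iid.
have indnu (J : {fset nat}) A : (forall i, measurable (A i)) ->
    P (cyl J A) = \prod_(i <- J) nu (A i).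
  by move=> mA; rewrite indX//; apply: eq_bigr => i _; exact: lawX.
elim: n => [|n IH] J A B Jn mA mB.
  have [Bz|nBz] := pselect (B z0).
    rewrite (_ : chain 0 @^-1` B = setT); last by apply/seteqP; split.
    rewrite setTI indnu//.
    have -> : P setT = 1 by exact: probability_setT.
    by rewrite mul1e.
  rewrite (_ : chain 0 @^-1` B = set0); last by apply/seteqP; split.
  by rewrite set0I measure0 mul0e.
have mcyl := measurable_cyl J mA.
pose p := \prod_(i <- J) nu (A i).
have p0 : 0 <= p by rewrite /p; apply: prode_ge0 => i _; exact: measure_ge0.
have pfin : p \is a fin_num by rewrite /p -indnu//; exact: fin_num_measure.
pose q : {nonneg R} := NngNum (fine_ge0 p0).
have qE : q%:num%:E = p by rewrite /= fineK.
have E C : measurable C ->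
    P (pair n @^-1` C `&` cyl J A) = (mscale q (lawZ n) \x nu) C.
  move=> mC; apply/esym.
  rewrite -[RHS]/(pushforward (mrestr P mcyl) (pair n) C).
  apply: product_measure_unique => // B' A' mB' mA'.
  have nJ : n \notin J by apply/negP => /Jn; rewrite ltnn.
  (* The constraint on [X n] is absorbed into the cylinder; n is a new coordinate because J starts
     at n + 1. *)
  pose A2 i := if i == n then A' else A i.
  have mA2 i : measurable (A2 i) by rewrite /A2; case: ifP.
  transitivity (P (chain n @^-1` B' `&` cyl (n |` J)%fset A2)).
    rewrite /pushforward /mrestr; congr (P _); apply/seteqP; split=> w /=.
      move=> [[Bw Aw] Jw]; split=> // i /=; rewrite inE => /orP[|iJ].
        by rewrite inE => /eqP ->; rewrite /A2 eqxx.
      by rewrite /A2; case: eqP => [->//|_]; exact: Jw.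
    move=> [Bw Aw]; split; first split=> //.
      by have := Aw n; rewrite /= /A2 eqxx; apply; rewrite !inE eqxx.
    move=> i /= iJ; have := Aw i; rewrite /= /A2; case: eqP => [ni|_].
      by move: iJ nJ; rewrite ni => ->.
    by apply; rewrite !inE iJ orbT.
  rewrite IH//; last first.
    by move=> i; rewrite !inE => /orP[/eqP ->//|/Jn /ltnW].
  rewrite big_fsetU1//= [A2 n]/A2 eqxx [X in _ * (_ * X)](_ : _ = p); last first.
    rewrite /p big_seq [RHS]big_seq; apply: eq_bigr => i iJ.
    by rewrite /A2; case: eqP => // ni; move: iJ nJ; rewrite ni => ->.
  by rewrite /mscale qE muleA muleC muleA.
have mFB : measurable (F @^-1` B) by exact: measurable_preimageT.
rewrite -[LHS]/(P (pair n @^-1` (F @^-1` B) `&` cyl J A)).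
rewrite E// /product_measure1 ge0_integral_mscale//; last first.
  exact: measurable_fun_xsection.
rewrite qE muleC; congr (_ * _).
by rewrite -[RHS]/(P (pair n @^-1` (F @^-1` B))) pair_law.
Qed.

(** Plays the role of conditioning on the first n variables: the next one is integrated against [nu]
    with the state held fixed. *)
Lemma ge0_integral_chain n (h : Z * T -> \bar R) :
  measurable_fun setT h -> (forall z, 0 <= h z) ->
  \int[P]_w h (chain n w, X n w) = \int[P]_w \int[nu]_y h (chain n w, y).
Proof.
move=> mh h0.
transitivity (\int[distribution P (pair_mfun n)]_z h z).
  by rewrite ge0_integral_distribution.
rewrite (eq_measure_integral (lawZ n \x nu)); last first.
  by move=> C mC _; apply: pair_law => //; exact: chain_future_independent.
rewrite fubini_tonelli1// ge0_integral_distribution//.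
- exact: measurable_fun_fubini_tonelli_F.
- by move=> z; apply: integral_ge0.
Qed.

End recursive_chain.

(** * Maximal inequality *)

(** From exp(-u) >= 1 - u comes exp u <= 1/(1 - u), and multiplying the claimed bound by 1 - u gives
    1 + u^2 (1 - 2u), at least 1 for u <= 1/2. *)
Lemma expR_le_quadratic (R : realType) (u : R) : `|u| <= 2^-1 ->
  expR u <= 1 + u + 2 * u ^+ 2.
Proof.
rewrite ler_norml => /andP[u1 u2].
have u3 : 0 < 1 - u by lra.
have : 1 - u <= expR (- u) by have := expR_ge1Dx (- u).
rewrite expRN => h; have : expR u <= (1 - u)^-1.
  by rewrite -[leLHS]invrK lef_pV2// posrE invr_gt0 expR_gt0.
move=> /le_trans; apply; rewrite -[leLHS]mul1r ler_pdivrMr//.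
have : 0 <= u ^+ 2 * (1 - 2 * u) by apply: mulr_ge0; [exact: sqr_ge0|lra].
have -> : (1 + u + 2 * u ^+ 2) * (1 - u) = 1 + u ^+ 2 * (1 - 2 * u) by ring.
by rewrite lerDl.
Qed.

Section exponential_maximal.
Context (R : realType) (G : topologicalGroupType).
Hypothesis mM : measurable_fun setT (@mulB G).
Context d (Omega : measurableType d) (P : probability Omega R).
Variables (X : nat -> {RV P >-> borel G}) (nu : probability (borel G) R).
Hypothesis X_iid : iid X nu.

Lemma random_walkE n w : random_walk X n w = chain X (1%g : borel G) (@mulB G) n w.
Proof.
rewrite /random_walk; elim: n => [|n IH] /=; first by rewrite big_geq.
by rewrite big_nat_recr//= IH.
Qed.

Lemma measurable_random_walk n : measurable_fun setT (random_walk X n).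
Proof.
rewrite (_ : random_walk X n = chain X (1%g : borel G) (@mulB G) n).
  exact: measurable_chain.
by apply/funext => w; exact: random_walkE.
Qed.

Lemma random_walk_law n S : measurable S ->
  P (random_walk X n @^-1` S) = gconvn mM nu n S.
Proof.
elim: n S => [|n IH] S mS.
  rewrite /gconvn /= diracE; case: (boolP (1%g \in S)) => S1.
    rewrite (_ : _ @^-1` _ = setT); first exact: probability_setT.
    by apply/seteqP; split=> // w _ /=; rewrite random_walkE; rewrite inE in S1.
  rewrite (_ : _ @^-1` _ = set0) ?measure0//.
  by rewrite -subset0 => w /=; rewrite random_walkE/=; move: S1; rewrite notin_setE.
rewrite gconvnSr// gconvE.
have mk := measurable_conv_kernel mM nu mS.
pose m_ : {mfun Omega >-> borel G} := mfun_Sub (mem_set (measurable_random_walk n)).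
rewrite (eq_measure_integral (distribution P m_)); last first.
  by move=> A mA _; exact/esym/IH.
rewrite ge0_integral_distribution//.
pose h (z : borel G * borel G) : \bar R := (\1_S (z.1 * z.2)%g)%:E.
have mh : measurable_fun setT h.
  by apply/measurable_EFinP; exact: (measurableT_comp (measurable_indic mS) mM).
have h0 z : (0 <= h z)%E by rewrite /h lee_fin.
have H := ge0_integral_chain X_iid (1%g : borel G) mM n mh h0.
transitivity (\int[P]_w h (chain X (1%g : borel G) (@mulB G) n w, X n w))%E.
  transitivity (\int[P]_w (\1_(random_walk X n.+1 @^-1` S) w)%:E)%E.
    rewrite integral_indic ?setIT//.
    by rewrite -[X in measurable X]setTI; exact: measurable_random_walk.
  apply: eq_integral => w _; rewrite indicE /h indicE; congr ((nat_of_bool _)%:R%:E).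
  by apply/idP/idP; rewrite !inE /= random_walkE.
rewrite H; apply: eq_integral => w _ /=; rewrite -random_walkE /h /=.
set x := random_walk X n w.
transitivity (\int[nu]_y (\1_((fun y : borel G => x * y)%g @^-1` S) y)%:E)%E; last first.
  by rewrite integral_indic ?setIT//; exact: preimage_lmul_measurable.
by apply: eq_integral => y _; rewrite !indicE; congr ((nat_of_bool _)%:R%:E).
Qed.

Variables (D : borel G * borel G -> R).
Hypothesis DK : bddmf 2^-1 D.
Hypothesis D0 : forall s, \int[nu]_y D (s, y) = 0.

(** [D (s, y)] is the increment when the walk at s takes the step y, and [D0] is the martingale
    property. *)
Definition martingale n w : R :=
  \sum_(0 <= i < n) D (random_walk X i w, X i w).

Section stopped.
Variables (t b : R).
Hypothesis t01 : 0 <= t <= 1.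

(* The second component is t M_n - n t^2, the logarithm of the exponential
   supermartingale, frozen as soon as it reaches b. *)
Definition stopped_step (z : (borel G * R) * borel G) : borel G * R :=
  ((z.1.1 * z.2)%g : borel G,
   if b <= z.1.2 then z.1.2 else z.1.2 + t * D (z.1.1, z.2) - t ^+ 2).

Lemma measurable_stopped_step : measurable_fun setT stopped_step.
Proof.
have m1 : measurable_fun setT (fun z : (borel G * R) * borel G => z.1.1).
  exact: (measurableT_comp measurable_fst measurable_fst).
have m2 : measurable_fun setT (fun z : (borel G * R) * borel G => z.1.2).
  exact: (measurableT_comp measurable_snd measurable_fst).
have m3 : measurable_fun setT (fun z : (borel G * R) * borel G => z.2).
  exact: measurable_snd.
have m13 := measurable_fun_pair m1 m3.
apply: measurable_fun_pair; first exact: (measurableT_comp mM m13).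
apply: measurable_fun_ifT => //.
  by apply: measurable_fun_ler => //; exact: measurable_cst.
apply: measurable_funB => //; apply: measurable_funD => //.
by apply: measurable_funM => //; exact: (measurableT_comp DK.1 m13).
Qed.

Definition stopped n w : borel G * R := chain X (1%g : borel G, 0 : R) stopped_step n w.

Lemma stopped_fst n w : (stopped n w).1 = random_walk X n w.
Proof.
rewrite random_walkE; elim: n => //= n IH.
by rewrite /stopped /= -IH.
Qed.

Lemma stopped_sndS n w : (stopped n.+1 w).2 =
  if b <= (stopped n w).2 then (stopped n w).2
  else (stopped n w).2 + t * D ((stopped n w).1, X n w) - t ^+ 2.
Proof. by []. Qed.

Lemma stopped_snd n w : b <= (stopped n w).2 \/
  (stopped n w).2 = t * martingale n w - n%:R * t ^+ 2.
Proof.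
elim: n => [|n]; first by right; rewrite /martingale big_geq//= mulr0 mul0r subrr.
rewrite stopped_sndS; case: ifP => [bW _|bW []]; [by left|by []|].
move=> ->; right; rewrite /martingale big_nat_recr//= -/(martingale n w).
by rewrite stopped_fst -natr1; ring.
Qed.

Lemma stopped_stays n m w : (n <= m)%N -> b <= (stopped n w).2 -> b <= (stopped m w).2.
Proof.
elim: m => [|m IH]; first by rewrite leqn0 => /eqP ->.
rewrite leq_eqVlt => /predU1P[-> //|]; rewrite ltnS => /IH/[apply] h.
by rewrite stopped_sndS h.
Qed.

(** Freezing preserves any earlier crossing of b, so a maximum over k <= n is controlled by the
    stopped value at the single time n. *)
Lemma martingale_stopped n k w : (k <= n)%N ->
  b <= t * martingale k w - k%:R * t ^+ 2 -> b <= (stopped n w).2.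
Proof.
by move=> kn bk; apply: (stopped_stays kn); case: (stopped_snd k w) => // ->.
Qed.

(** Since |D| <= 1/2 and t <= 1, exp(t D) <= 1 + t D + t^2/2. The linear term integrates to zero,
    and 1 + t^2/2 <= exp(t^2) is paid for by the compensator t^2. A frozen value gives equality. *)
Let expint s v : (\int[nu]_y (expR (stopped_step ((s, v), y)).2)%:E <= (expR v)%:E)%E.
Proof.
have Ds := bddmf_section DK s.
have [bv|/negbTE bv] := boolP (b <= v); rewrite /stopped_step /= bv.
  rewrite integral_cst//.
  have -> : (nu : {measure set (borel G) -> \bar R}) setT = 1%E by exact: probability_setT.
  by rewrite mule1.
pose c := expR (v - t ^+ 2).
have c0 : 0 <= c by exact: expR_ge0.
have KD := bddmfD (bddmf_cst (borel G) (c * (1 + t ^+ 2 / 2))) (bddmfZ (c * t) Ds).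
apply: (@le_trans _ _ (\int[nu]_y (c * (1 + t ^+ 2 / 2) + c * t * D (s, y))%:E)%E).
  have le y : expR (v + t * D (s, y) - t ^+ 2) <=
      c * (1 + t ^+ 2 / 2) + c * t * D (s, y).
    rewrite (_ : v + _ - _ = (v - t ^+ 2) + t * D (s, y)); last by ring.
    rewrite expRD -/c -mulrA -mulrDr ler_wpM2l//.
    have [t0 t1] := andP t01; have Dy := DK.2 (s, y).
    apply: le_trans (expR_le_quadratic _) _.
      by rewrite normrM (ger0_norm t0) -[leRHS]mul1r ler_pM.
    have D2 : D (s, y) ^+ 2 <= 2^-1 ^+ 2.
      by rewrite -real_normK ?num_real// lerXn2r// nnegrE.
    have := ler_wpM2l (sqr_ge0 t) D2; rewrite exprMn; lra.
  apply: ge0_le_integral => //.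
  - apply/measurable_EFinP; apply: measurableT_comp => //.
    apply: measurable_funB => //; apply: measurable_funD => //.
    by apply: measurable_funM => //; exact: Ds.1.
  - by apply/measurable_EFinP; exact: KD.1.
  - by move=> y _; rewrite lee_fin.
rewrite -(EFin_Rintegral nu KD) lee_fin.
rewrite (RintegralDP nu (bddmf_cst _ _) (bddmfZ (c * t) Ds)).
rewrite (Rintegral_cstP nu (c * (1 + t ^+ 2 / 2))) (RintegralZP nu (c * t) Ds) D0 mulr0 addr0.
rewrite -[v](subrK (t ^+ 2)) expRD -/c ler_wpM2l//.
apply: le_trans (expR_ge1Dx (t ^+ 2)).
by rewrite lerD2l ler_pdivrMr// ler_peMr// ?sqr_ge0// ler1n.
Qed.

Lemma stopped_expectation n : (\int[P]_w (expR (stopped n w).2)%:E <= 1)%E.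
Proof.
have mexp : measurable_fun setT (fun z : borel G * R => (expR z.2)%:E).
  by apply/measurable_EFinP; apply: measurableT_comp => //; exact: measurable_snd.
elim: n => [|n IH].
  rewrite /stopped /= expR0 integral_cst//.
  by have -> : (P : {measure set Omega -> \bar R}) setT = 1%E;
    [exact: probability_setT|rewrite mule1].
apply: le_trans IH.
pose h z := (expR (stopped_step z).2)%:E.
have mh : measurable_fun setT h := measurableT_comp mexp measurable_stopped_step.
have h0 z : (0 <= h z)%E by rewrite lee_fin expR_ge0.
have := ge0_integral_chain X_iid (1%g : borel G, 0 : R) measurable_stopped_step n mh h0.
rewrite -[X in X = _ -> _]/(\int[P]_w (expR (stopped n.+1 w).2)%:E)%E => ->.
have ms := measurable_chain X (1%g : borel G, 0 : R) measurable_stopped_step n.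
apply: ge0_le_integral => //.
- by move=> w _; apply: integral_ge0 => y _; exact: h0.
- have mh2 : measurable_fun setT (fubini_F nu h) by exact: measurable_fun_fubini_tonelli_F.
  exact: (measurableT_comp mh2 ms).
- exact: (measurableT_comp mexp ms).
- move=> w _; rewrite /h -/(stopped n w); case: (stopped n w) => s v.
  exact: expint.
Qed.

Lemma measurable_stopped_event n : measurable [set w | b <= (stopped n w).2].
Proof.
have ms : measurable_fun setT (fun w => (stopped n w).2).
  apply: (measurableT_comp measurable_snd).
  exact: (measurable_chain X (1%g : borel G, 0 : R) measurable_stopped_step n).
rewrite -[X in measurable X]setTI; apply: measurable_fun_le => //.
Qed.

(** Markov's inequality for the exponential of the stopped value, whose expectation is at most 1.
    Combined with [martingale_stopped] it is a maximal inequality. *)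
Lemma stopped_tail n : (P [set w | (b <= (stopped n w).2)%R] <= (expR (- b))%:E)%E.
Proof.
have mA := measurable_stopped_event n.
have ms : measurable_fun setT (fun w => (expR (stopped n w).2)%:E).
  apply/measurable_EFinP; apply: measurableT_comp => //.
  apply: (measurableT_comp measurable_snd).
  exact: (measurable_chain X (1%g : borel G, 0 : R) measurable_stopped_step n).
set A := [set w | _] in mA *.
have : ((expR b)%:E * P A <= 1)%E.
  rewrite -integral_cst//; apply: le_trans (stopped_expectation n).
  apply: (@le_trans _ _ (\int[P]_(w in A) (expR (stopped n w).2)%:E)%E).
    apply: ge0_le_integral => //.
    - by move=> w _; rewrite lee_fin expR_ge0.
    - exact: measurable_funTS.
    - by move=> w Aw; rewrite lee_fin ler_expR.
  by apply: ge0_subset_integral => // w _; rewrite lee_fin expR_ge0.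
have : P A \is a fin_num by exact: fin_num_measure.
case: (P A) => [p| |]// _; rewrite -EFinM !lee_fin expRN.
by rewrite -ler_pdivlMl ?expR_gt0// mulr1.
Qed.

End stopped.
End exponential_maximal.

(** * The iterated logarithm bound *)

Lemma ln_natr_le (R : realType) (n : nat) : ln n%:R <= n%:R :> R.
Proof.
case: n => [|n]; first by rewrite ln0.
by apply/ltW/ln_sublinear; rewrite ltr0n.
Qed.

Lemma sum_inv_sqr_le (R : realFieldType) n :
  \sum_(0 <= k < n) (k.+1%:R ^+ 2)^-1 <= 2 :> R.
Proof.
(* The stronger bound makes the induction close: its increments 2/((n+1)(n+2)) are at least
   1/(n+1)^2. *)
suff : \sum_(0 <= k < n) (k.+1%:R ^+ 2)^-1 <= 2 - 2 / n.+1%:R :> R.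
  by move=> /le_trans; apply; rewrite gerBl.
elim: n => [|n IH]; first by rewrite big_geq// divr1 subrr.
rewrite big_nat_recr//=; apply: le_trans (lerD IH (lexx _)) _.
rewrite -[n.+2%:R]natr1; set x : R := n.+1%:R.
have x1 : 1 <= x by rewrite ler1n.
rewrite -subr_ge0.
have -> : 2 - 2 / (x + 1) - (2 - 2 / x + (x ^+ 2)^-1) =
    (x - 1) / (x ^+ 2 * (x + 1)) by field; apply/andP; split; rewrite gt_eqF//; lra.
by rewrite divr_ge0 ?mulr_ge0// ?exprn_ge0//; lra.
Qed.

Section lil.
Context (R : realType) (G : topologicalGroupType).
Hypothesis mM : measurable_fun setT (@mulB G).
Context d (Omega : measurableType d) (P : probability Omega R).
Variables (X : nat -> {RV P >-> borel G}) (nu : probability (borel G) R).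
Hypothesis X_iid : iid X nu.

(* With this t, the compensator t^2 2^j over the block j is ln j, of the same order
   as the level b = 2 ln j, for which exp (- b) is summable. *)
Definition block_rate (j : nat) : R := Num.sqrt (ln j%:R / 2 ^+ j).

Lemma block_rate01 j : 0 <= block_rate j <= 1.
Proof.
rewrite sqrtr_ge0/= -[leRHS]sqrtr1 ler_sqrt// ler_pdivrMr ?exprn_gt0// mul1r.
apply: le_trans (ln_natr_le _ _) _.
by rewrite -natrX ler_nat ltnW// ltn_expl.
Qed.

Lemma block_rate_sqr j : 2 ^+ j * block_rate j ^+ 2 = ln j%:R.
Proof.
rewrite sqr_sqrtr; last first.
  apply: divr_ge0; last exact: exprn_ge0.
  by case: j => [|j]; [rewrite ln0|rewrite ln_ge0// ler1n].
by rewrite mulrC divfK// expf_neq0.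
Qed.

(** Outside [A j] the level 2 ln j is not reached by time 2^j, and the compensator adds at most 2^j
    t^2 = ln j; this makes 3 ln j. The tail bound is j^-2, so Borel-Cantelli applies. *)
Lemma martingale_block_upper (D : borel G * borel G -> R) : bddmf 2^-1 D ->
  (forall s, \int[nu]_y D (s, y) = 0) ->
  {ae P, forall w, \forall j \near \oo, forall k, (k <= 2 ^ j)%N ->
     block_rate j * martingale X D k w <= 3 * ln j%:R}.
Proof.
move=> DK D0.
pose A j := [set w | 2 * ln j%:R <= (stopped X D (block_rate j) (2 * ln j%:R) (2 ^ j) w).2].
have mA j : measurable (A j) by exact: measurable_stopped_event.
(* The shift avoids j = 0, where exp(-2 ln j) is not j^-2. *)
have PA j : (P (A j.+1) <= ((j.+1%:R ^+ 2)^-1)%:E)%E.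
  apply: le_trans (stopped_tail mM X_iid DK D0 _ (block_rate01 _) _) _.
  by rewrite lee_fin expRN (expRM_natl 2) lnK ?posrE.
have A0 : P (lim_sup_set (fun j => A j.+1)) = 0%E.
  apply: lim_sup_set_cvg0 => [k|]; first exact: mA.
  apply: (@le_lt_trans _ _ 2%:E); last exact: ltry.
  apply: lime_le; first exact: is_cvg_nneseries.
  apply: nearW => n; apply: (@le_trans _ _ (\sum_(0 <= k < n) ((k.+1%:R ^+ 2)^-1)%:E)%E).
    by apply: lee_sum => k _; exact: PA.
  by rewrite sumEFin lee_fin sum_inv_sqr_le.
exists (lim_sup_set (fun j => A j.+1)); split=> //.
  apply: bigcapT_measurable => n; apply: bigcup_measurable => j _; exact: mA.
move=> w /= nw; apply: contrapT => nlim; apply: nw.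
have [n nA] : exists n, forall j, (n <= j)%N -> ~ A j.+1 w.
  apply: contrapT => nn; apply: nlim => n _; apply: contrapT => nj.
  by apply: nn; exists n => j nj' Aj; apply: nj; exists j.
exists n.+1 => // -[//|j] /= nj k kj; rewrite leNgt; apply/negP => h.
apply: (nA j nj); apply: (martingale_stopped (k := k)) => //.
rewrite lerBrDr ltW//; apply: le_lt_trans h.
have : k%:R * block_rate j.+1 ^+ 2 <= ln j.+1%:R.
  rewrite -block_rate_sqr ler_wpM2r ?sqr_ge0//.
  by rewrite -natrX ler_nat.
lra.
Qed.

Lemma martingale_block (D : borel G * borel G -> R) : bddmf 2^-1 D ->
  (forall s, \int[nu]_y D (s, y) = 0) ->
  {ae P, forall w, \forall j \near \oo, forall k, (k <= 2 ^ j)%N ->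
     block_rate j * `|martingale X D k w| <= 3 * ln j%:R}.
Proof.
move=> DK D0; pose D' z := - D z.
have DK' : bddmf 2^-1 D'.
  by split=> [|z]; [exact: measurable_funN DK.1|rewrite normrN; exact: DK.2].
have D0' s : \int[nu]_y D' (s, y) = 0.
  have Ds := bddmf_section DK s.
  have := RintegralZP nu (-1) Ds; rewrite D0 mulr0 => <-.
  by apply: eq_Rintegral => y _; rewrite mulN1r.
have up := martingale_block_upper DK D0; have lo := martingale_block_upper DK' D0'.
near=> w.
have h1 : \forall j \near \oo, forall k, (k <= 2 ^ j)%N ->
  block_rate j * martingale X D k w <= 3 * ln j%:R by near: w.
have h2 : \forall j \near \oo, forall k, (k <= 2 ^ j)%N ->
  block_rate j * martingale X D' k w <= 3 * ln j%:R by near: w.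
near=> j => k kj.
have k1 : block_rate j * martingale X D k w <= 3 * ln j%:R.
  by move: k kj; near: j.
have : block_rate j * martingale X D' k w <= 3 * ln j%:R.
  by move: k kj {k1}; near: j.
rewrite /martingale sumrN mulrN -/(martingale X D k w) => k2.
have [m0|m0] := leP 0 (martingale X D k w); first by rewrite ger0_norm.
by rewrite ltr0_norm// mulrN.
Unshelve. all: by end_near. Qed.

End lil.

Lemma ln2_ge_half (R : realType) : 2^-1 <= ln 2 :> R.
Proof.
rewrite -[leLHS]expRK ler_ln ?posrE ?expR_gt0//.
have : (1 - 2^-1) * expR (2^-1 : R) <= 1.
  by rewrite -ler_pdivlMr ?expR_gt0// div1r -expRN; exact: expR_ge1Dx.
by lra.
Qed.

(** Take 2^(j-1) <= N < 2^j. Squaring the hypothesis and dividing by ln j gives |m N|^2 <= 9 * 2^j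
    ln j; with 2^j <= 2N and ln j <= 2 ln ln N this is at most 36 N ln ln N, whence the 6. *)
Lemma block_to_lil (R : realType) (m : nat -> R) :
  (\forall j \near \oo, forall k, (k <= 2 ^ j)%N ->
     block_rate R j * `|m k| <= 3 * ln j%:R) ->
  \forall N \near \oo, `|m N| <= 6 * Num.sqrt (N%:R * ln (ln N%:R)).
Proof.
move=> [j0 _ jP].
near=> N.
(* As 64 = 2^6 and ln 2 >= 1/2, this gives ln N >= 3, from which j <= 2 ln N + 1 <= (ln N)^2. *)
have N64 : (64 <= N)%N by near: N; exists 64%N.
have Nj0 : (2 ^ j0 <= N)%N by near: N; exists (2 ^ j0)%N.
have N0 : (0 < N)%N by exact: leq_trans N64.
have ln64 : 3 <= ln N%:R :> R.
  apply: (@le_trans _ _ (ln (2 ^+ 6))); last first.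
    by rewrite ler_ln ?posrE ?ltr0n ?exprn_gt0// -natrX ler_nat.
  by rewrite lnXn// -mulr_natr; have := ln2_ge_half R; lra.
pose k := trunc_log 2 N; pose j := k.+1.
have /andP[kN Nk] := trunc_log_bounds (isT : (1 < 2)%N) N0.
have jj0 : (j0 <= j)%N.
  by rewrite ltnW// ltnS; apply: trunc_log_max.
have := jP j jj0 N (ltnW Nk) => h.
have j1 : 1 <= j%:R :> R by rewrite ler1n.
have kln : k%:R <= 2 * ln N%:R :> R.
  have : ln (2 ^+ k) <= ln N%:R :> R.
    by rewrite ler_ln ?posrE ?exprn_gt0// ?ltr0n// -natrX ler_nat.
  rewrite lnXn// -[_ *+ k]mulr_natr => h'.
  have : 2^-1 * k%:R <= ln 2 * k%:R :> R by rewrite ler_wpM2r// ln2_ge_half.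
  lra.
have lj : ln j%:R <= 2 * ln (ln N%:R) :> R.
  rewrite (mulr_natl (ln (ln _)) 2) -lnXn; last by lra.
  rewrite ler_ln ?posrE ?ltr0n//; last by rewrite exprn_gt0//; lra.
  rewrite -natr1; apply: le_trans (lerD kln (lexx 1)) _.
  rewrite -subr_ge0 (_ : _ - _ = (ln N%:R - 3) * (ln N%:R + 1) + 2); last by ring.
  by apply: addr_ge0 => //; apply: mulr_ge0; lra.
have lj0 : 0 < ln j%:R :> R.
  rewrite ln_gt0// ltr1n ltnS /k.
  by apply: (@trunc_log_max 2 N 1) => //; apply: leq_trans N64.
have sq : (block_rate R j * `|m N|) ^+ 2 <= (3 * ln j%:R) ^+ 2.
  rewrite lerXn2r// ?nnegrE; last by rewrite mulr_ge0// ltW.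
  by rewrite mulr_ge0//; have /andP[] := block_rate01 R j.
have m2 : `|m N| ^+ 2 <= 9 * (2 ^+ j * ln j%:R).
  have : ln j%:R * `|m N| ^+ 2 <= ln j%:R * (9 * (2 ^+ j * ln j%:R)).
    rewrite -{1}block_rate_sqr -mulrA -exprMn.
    apply: le_trans (ler_wpM2l _ sq) _; first exact: exprn_ge0.
    by rewrite le_eqVlt; apply/orP; left; apply/eqP; ring.
  by rewrite ler_pM2l.
have jN : 2 ^+ j <= 2 * N%:R :> R.
  by rewrite exprS ler_pM2l// -natrX ler_nat.
have L0 : 0 < ln (ln N%:R) :> R by rewrite ln_gt0//; lra.
rewrite -[leLHS]ger0_norm// -sqrtr_sqr.
have -> : 6 = Num.sqrt (6 ^+ 2) :> R by rewrite sqrtr_sqr ger0_norm.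
rewrite -sqrtrM ?sqr_ge0// ler_sqrt; last first.
  by rewrite mulr_ge0 ?sqr_ge0// mulr_ge0// ltW.
apply: le_trans m2 _.
have : 2 ^+ j * ln j%:R <= (2 * N%:R) * (2 * ln (ln N%:R)) :> R.
  by apply: ler_pM => //; exact: ltW.
lra.
Unshelve. all: by end_near. Qed.

(** Eventual boundedness is the working form of (iii). It ignores the small N, where the iterated
    logarithm and the division take default values. *)
Lemma limn_esup_lty (R : realType) (x : nat -> R) :
  (limn_esup (fun n => (x n)%:E) < +oo)%E <->
  exists C, \forall n \near \oo, x n <= C.
Proof.
rewrite /limn_esup limf_esupE; split=> [h|[C [n0 _ nC]]].
  have [_ [V VF <-] ylt] := ereal_inf_lt h.
  have [C sC] : exists C : R, (ereal_sup ((fun n => (x n)%:E) @` V) <= C%:E)%E.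
    case: (ereal_sup _) ylt => [r _| //|_]; first by exists r.
    by exists 0; rewrite leNye.
  exists C; apply: filterS VF => n Vn; rewrite -lee_fin; apply: le_trans sC.
  by apply: ereal_sup_ubound; exists n.
apply: (@le_lt_trans _ _ C%:E); last exact: ltry.
apply: (@le_trans _ _ (ereal_sup ((fun n => (x n)%:E) @` [set n | (n0 <= n)%N]))).
  by apply: ereal_inf_lbound; exists [set n | (n0 <= n)%N] => //; exists n0.
by apply: ge_ereal_sup => _ [n nn <-]; rewrite lee_fin; exact: nC.
Qed.

(** With q = sqrt N, ln ln N <= ln N = 2 ln q <= 2q. After squaring, the error is below e N as soon
    as q > 2 C'^2 / e^2. *)
Lemma lil_bound_cvg (R : realType) (s : nat -> R) (m : R) :
  (exists C, \forall N \near \oo,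
     `|s N - N%:R * m| / Num.sqrt (N%:R * ln (ln N%:R)) <= C) ->
  N%:R^-1 * s N @[N --> \oo] --> m.
Proof.
move=> [C bC]; apply/cvgrPdist_lt => e e0.
pose C' := Num.max C 1.
have C1 : 1 <= C' by rewrite /C' le_max lexx orbT.
near=> N.
have N3 : (8 <= N)%N by near: N; exists 8%N.
have N0 : 0 < N%:R :> R by rewrite ltr0n; exact: leq_trans N3.
have lnN : 1 < ln N%:R :> R.
  apply: (@lt_le_trans _ _ (ln (2 ^+ 3))); last first.
    by rewrite ler_ln ?posrE ?exprn_gt0// -natrX ler_nat.
  by rewrite lnXn// -[_ *+ 3]mulr_natr; have := ln2_ge_half R; lra.
have L0 : 0 < ln (ln N%:R) :> R by rewrite ln_gt0.
pose q := Num.sqrt (N%:R : R).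
have q0 : 0 < q by rewrite sqrtr_gt0.
have qq : q ^+ 2 = N%:R by rewrite sqr_sqrtr// ltW.
have Lq : ln (ln N%:R) <= 2 * q.
  apply: (@le_trans _ _ (ln N%:R)); first by apply/ltW/ln_sublinear; lra.
  by rewrite -qq lnXn// -[_ *+ 2]mulr_natl ler_pM2l// ltW// ln_sublinear.
have NC : `|s N - N%:R * m| <= C' * Num.sqrt (N%:R * ln (ln N%:R)).
  rewrite -ler_pdivrMr ?sqrtr_gt0 ?mulr_gt0//.
  apply: (@le_trans _ _ C); last by rewrite /C' le_max lexx.
  by near: N.
have qe : 2 * C' ^+ 2 / e ^+ 2 < q.
  have : (2 * C' ^+ 2 / e ^+ 2) ^+ 2 < N%:R.
    by near: N; exact: nbhs_infty_gtr.
  rewrite -qq ltr_pXn2r ?nnegrE//; last exact: ltW.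
  by apply: divr_ge0; [apply: mulr_ge0 => //|]; exact: sqr_ge0.
have -> : m - N%:R^-1 * s N = - (N%:R^-1 * (s N - N%:R * m)).
  by field; rewrite gt_eqF.
rewrite normrN normrM ger0_norm ?invr_ge0 ?ltW// mulrC ltr_pdivrMr//.
apply: le_lt_trans NC _.
rewrite -ltr_sqr ?nnegrE ?mulr_ge0 ?sqrtr_ge0// ?ltW// ?(lt_le_trans ltr01)//.
rewrite !exprMn sqr_sqrtr; last by rewrite mulr_ge0// ltW.
have qe' : 2 * C' ^+ 2 < q * e ^+ 2 by rewrite -ltr_pdivrMr// exprn_gt0.
have CL : C' ^+ 2 * ln (ln N%:R) < N%:R * e ^+ 2.
  apply: (@le_lt_trans _ _ (C' ^+ 2 * (2 * q))); first by rewrite ler_wpM2l// sqr_ge0.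
  rewrite -qq expr2 -mulrA mulrCA [ltLHS](_ : _ = q * (2 * C' ^+ 2)); last by ring.
  rewrite [ltRHS](_ : _ = q * (q * e ^+ 2)); last by ring.
  by rewrite ltr_pM2l.
have := CL; rewrite -(ltr_pM2l N0) => CN.
have -> : C' ^+ 2 * (N%:R * ln (ln N%:R)) = N%:R * (C' ^+ 2 * ln (ln N%:R)).
  by ring.
by apply: lt_le_trans CN _; rewrite le_eqVlt; apply/orP; left; apply/eqP; ring.
Unshelve. all: by end_near. Qed.

(** * From the martingale bound to the centred sums of f *)

Section sufficiency.
Context (R : realType) (G : topologicalGroupType).
Hypothesis mM : measurable_fun setT (@mulB G).
Variables (mu : probability (borel G) R) (nu : probability (borel G) R).
Context d (Omega : measurableType d) (P : probability Omega R).
Variables (X : nat -> {RV P >-> borel G}).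
Hypothesis X_iid : iid X nu.

Lemma random_walkS k w : random_walk X k.+1 w = (random_walk X k w * X k w)%g.
Proof. by rewrite /random_walk big_nat_recr. Qed.

(** Each f(S_k) - m is g(S_k) - L g(S_(k-1)), a martingale increment, plus a telescoping difference
    of values of L g. The factor a is free, to be chosen so that the increments obey the bound
    1/2. *)
Lemma poisson_martingale (f g : borel G -> R) m a N w : a != 0 ->
  (forall x, g x - transop nu g x = f x - m) ->
  \sum_(1 <= k < N.+1) f (random_walk X k w) - N%:R * m =
  a^-1 * martingale X (fun z => a * (g (z.1 * z.2)%g - transop nu g z.1)) N w
  + transop nu g (random_walk X 0 w) - transop nu g (random_walk X N w).
Proof.
move=> a0 gE; elim: N => [|N IH].
  by rewrite big_geq// /martingale big_geq// mul0r mulr0 subrr add0r subrr.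
rewrite big_nat_recr//= -natr1 mulrDl mul1r opprD addrACA IH.
rewrite /martingale [in RHS]big_nat_recr//= -/(martingale _ _ _ _) -gE random_walkS.
by rewrite mulrDr mulKf//; ring.
Qed.

Lemma lil_of_poisson (f g : borel G -> R) m K : bddmf K g ->
  (forall x, g x - transop nu g x = f x - m) ->
  {ae P, forall w, exists C, \forall N \near \oo,
    `|\sum_(1 <= k < N.+1) f (random_walk X k w) - N%:R * m|
      / Num.sqrt (N%:R * ln (ln N%:R)) <= C}.
Proof.
move=> gK gE.
have K0 : 0 <= K by apply: le_trans (gK.2 point).
(* Unscaled increments are at most 2K, so scaled ones are at most 1/2; the 1 keeps a defined when K
   = 0. *)
pose a : R := (4 * (K + 1))^-1.
have a0 : 0 < a by rewrite invr_gt0; lra.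
have TK := bddmf_transop mM nu gK.
pose D (z : borel G * borel G) := a * (g (z.1 * z.2)%g - transop nu g z.1).
have DK : bddmf 2^-1 D.
  have T1 : bddmf K (fun z : borel G * borel G => transop nu g z.1).
    exact: (bddmf_comp (g := fst) TK measurable_fst).
  have [mD DK] := bddmfZ a (bddmfB (bddmf_mulB mM gK) T1).
  split=> // z; apply: le_trans (DK z) _; rewrite (ger0_norm (ltW a0)).
  rewrite /a ler_pdivrMl; lra.
have D0 s : \int[nu]_y D (s, y) = 0.
  rewrite /D /= (RintegralZP nu a (bddmfB (bddmf_lmul s gK) (bddmf_cst _ (transop nu g s)))).
  rewrite (RintegralBP nu (bddmf_lmul s gK) (bddmf_cst _ (transop nu g s))).
  by rewrite (Rintegral_cstP nu (transop nu g s)) subrr mulr0.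
apply: filterS (martingale_block mM X_iid DK D0) => w /block_to_lil mw.
(* The 6 is that of [block_to_lil] with the scaling undone; 2K bounds the two boundary terms,
   absorbed because the normalizer is at least 1 for N >= 64. *)
exists (a^-1 * 6 + 2 * K); near=> N.
have N64 : (64 <= N)%N by near: N; exists 64%N.
have N1 : 64 <= N%:R :> R by rewrite ler_nat.
have ln64 : 3 <= ln N%:R :> R.
  apply: (@le_trans _ _ (ln (2 ^+ 6))); last first.
    by rewrite ler_ln ?posrE ?exprn_gt0//; [rewrite -natrX ler_nat|lra].
  by rewrite lnXn// -[_ *+ 6]mulr_natr; have := ln2_ge_half R; lra.
have L2 : 2^-1 <= ln (ln N%:R) :> R.
  apply: le_trans (ln2_ge_half R) _; rewrite ler_ln ?posrE; lra.
have : `|martingale X D N w| <= 6 * Num.sqrt (N%:R * ln (ln N%:R)) by near: N.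
set S := Num.sqrt _ => hM.
have S1 : 1 <= S.
  rewrite -sqrtr1 ler_sqrt; last by rewrite mulr_ge0; lra.
  have : 64 * 2^-1 <= N%:R * ln (ln N%:R) :> R by apply: ler_pM; lra.
  lra.
rewrite ler_pdivrMr ?(lt_le_trans ltr01)// (poisson_martingale N w (lt0r_neq0 a0) gE).
have := TK.2 (random_walk X 0 w); have := TK.2 (random_walk X N w).
rewrite -/(martingale X D N w); move: hM; set M := martingale _ _ _ _ => hM h1 h2.
apply: le_trans (ler_normB _ _) _.
apply: le_trans (lerD (ler_normD _ _) h1) _.
have a1 : 0 <= a^-1 by rewrite invr_ge0 ltW.
rewrite normrM (ger0_norm a1).
have e1 : a^-1 * `|M| <= a^-1 * (6 * S) by rewrite ler_wpM2l.
have e2 : 2 * K <= 2 * K * S by rewrite ler_peMr// mulr_ge0.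
have -> : (a^-1 * 6 + 2 * K) * S = a^-1 * (6 * S) + 2 * K * S by rewrite mulrDl mulrA.
apply: le_trans (lerD (lerD e1 h2) (lexx K)) _.
by rewrite -addrA lerD2l -mulr2n -(mulr_natl K).
Unshelve. all: by end_near. Qed.

End sufficiency.

(** * Necessity *)

(** Exhaustion: a countable union U of [mu]-null sets attains the supremum of m over null sets. The
    singular part is m restricted to U, the absolutely continuous part m restricted to its
    complement. *)
Lemma lebesgue_decomposition_exists d (T : measurableType d) (R : realType)
    (m mu : probability T R) :
  exists m_abs m_sing : {measure set T -> \bar R},
    lebesgue_decomposition m mu m_abs m_sing.
Proof.
pose V := [set m N | N in [set N | measurable N /\ mu N = 0%E]].
have V0 : V 0%E by exists set0; rewrite ?measure0//; split; rewrite ?measure0.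
have supfin : ereal_sup V \is a fin_num.
  rewrite ge0_fin_numE; last exact: ereal_sup_ubound.
  apply: (@le_lt_trans _ _ 1%E); last exact: ltry.
  by apply: ge_ereal_sup => _ [N [mN _] <-]; exact: probability_le1.
have /choice[N NP] n : exists N, [/\ measurable N, mu N = 0%E &
    (ereal_sup V - (n.+1%:R^-1)%:E < m N)%E].
  have n0 : 0 < n.+1%:R^-1 :> R by rewrite invr_gt0.
  by have [_ [N [mN N0] <-] Nn] := ub_ereal_sup_adherent n0 supfin; exists N.
pose U := \bigcup_n N n.
have mU : measurable U by apply: bigcupT_measurable => n; have [] := NP n.
have U0 : mu U = 0%E.
  apply: measure_negligible => //; apply: negligible_bigcup => n.
  by have [mN N0 _] := NP n; exact/negligibleP.
have Usup : (ereal_sup V <= m U)%E.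
  apply/lee_addgt0Pr => e e0.
  have [n _ /(_ n (leqnn n)) /= ne] := near_infty_natSinv_lt (PosNum e0).
  have [mN _ Nn] := NP n; rewrite -leeBlDr//.
  apply: (@le_trans _ _ (ereal_sup V - (n.+1%:R^-1)%:E)%E).
    by rewrite leeD2l// leeN2 lee_fin ltW.
  apply: le_trans (ltW Nn) _; apply: le_measure; rewrite ?inE//.
  exact: bigcup_sup.
have mCU : measurable (~` U) by exact: measurableC.
exists (mrestr m mCU), (mrestr m mU); split.
- by move=> A mA; exact: measureDI.
- apply/null_content_dominatesP => A mA A0; rewrite /mrestr.
  have mAU : measurable (A `&` ~` U) by exact: measurableI.
  apply/eqP; rewrite eq_le measure_ge0 andbT.
  (* Adding the null set A to U gives another competitor, so by maximality A outside U has no mass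
     under m. *)
  have UA : (m (U `|` (A `&` ~` U)) <= ereal_sup V)%E.
    apply: ereal_sup_ubound; exists (U `|` (A `&` ~` U)) => //; split.
      exact: measurableU.
    apply: measure_negligible; first exact: measurableU.
    apply: negligibleU; first exact/negligibleP.
    by apply: (@negligibleS _ _ _ _ A); [exact: subIsetl|exact/negligibleP].
  move: UA; rewrite measureU//; last first.
    by rewrite setICA setICr setI0.
  have mUfin : m U \is a fin_num by exact: fin_num_measure.
  move=> /le_trans/(_ Usup); rewrite -[X in (_ <= X)%E]adde0 leeD2lE//.
- by exists U; split => //; rewrite /= /mrestr setICl measure0.
Qed.

Section necessity.
Context (R : realType) (G : topologicalGroupType).
Hypothesis mM : measurable_fun setT (@mulB G).
Variables (mu : probability (borel G) R) (mu_haar : normalized_haar mu).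
Variable nu : probability (borel G) R.
Context d (Omega : measurableType d) (P : probability Omega R).
Variables (X : nat -> {RV P >-> borel G}).
Hypothesis X_iid : iid X nu.
Hypothesis slln : forall f : borel G -> R, measurable_fun setT f -> bounded_fun f ->
  {ae P, forall w,
    N%:R^-1 * (\sum_(1 <= k < N.+1) f (random_walk X k w)) @[N --> \oo]
      --> \int[mu]_x f x}.

Lemma full_of_always_visited (B : set (borel G)) : measurable B ->
  {ae P, forall w, forall k, B (random_walk X k.+1 w)} -> mu B = 1%E.
Proof.
move=> mB BP.
have mf : measurable_fun setT (\1_B : borel G -> R) by exact: measurable_indic.
have bf : bounded_fun (\1_B : borel G -> R).
  exists 1; split; first exact: num_real.
  move=> x x1 y _; apply: le_trans (ltW x1).
  by rewrite indicE; case: (_ \in _); rewrite ?normr1 ?normr0.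
have PT : (0 < P setT)%E.
  by have -> : P setT = 1%E by exact: probability_setT.
(* Positive total mass gives one sample point in both almost sure events; the two limits are
   compared there. *)
have PF := ae_properfilter_algebraOfSetsType PT.
have [w [wB wlim]] : exists w, (forall k, B (random_walk X k.+1 w)) /\
    (N%:R^-1 * (\sum_(1 <= k < N.+1) \1_B (random_walk X k w)) @[N --> \oo]
      --> \int[mu]_x (\1_B x)).
  by apply: (@filter_ex _ _ PF); apply: filterI => //; exact: slln.
have lim1 : N%:R^-1 * (\sum_(1 <= k < N.+1) \1_B (random_walk X k w)) @[N --> \oo] --> (1 : R).
  apply: cvg_near_cst; exists 1%N => // N /= N1.
  rewrite big_add1 /= (eq_bigr (fun=> 1)); last first.
    by move=> k _; rewrite indicE mem_set.
  by rewrite big_mkord sumr_const card_ord mulVf// pnatr_eq0 -lt0n.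
have := cvg_unique _ wlim lim1 => /(_ (@Rhausdorff R)) E.
have : (\int[mu]_x (\1_B x))%:E = 1%E by rewrite E.
have BK : bddmf 1 (\1_B : borel G -> R).
  by split=> // x; rewrite indicE; case: (_ \in _); rewrite ?normr1 ?normr0.
by rewrite (EFin_Rintegral mu BK) integral_indic// setIT.
Qed.

(** A closed subgroup H containing the support gets [mu]-measure 1. If g is outside H, the coset g H
    is disjoint from H and also has measure 1, which is too much. *)
Lemma adapted_of_slln (U : nat -> set (borel G)) : open_basis U -> adapted nu.
Proof.
move=> [oU UP] H clH gH HT sub.
have mH : measurable (H : set (borel G)) by exact: closed_measurable_borel.
have HM x y : H x -> H y -> H (x * y)%g.
  by move=> Hx Hy; have h := group_closedM gH; have := h x y; rewrite !inE; apply.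
have HV x : H x -> H (x^-1)%g.
  by move=> Hx; have h := group_closedV gH; have := h x; rewrite !inE; apply.
have nuH : nu (~` H) = 0%E.
  apply: measure_negligible; first exact: measurableC.
  (* Every point outside the support has a null basic neighbourhood, and there are countably many of
     these; so the complement of the support is null. *)
  pose F i := if `[< nu (U i) = 0%E >] then U i else set0.
  apply: (@negligibleS _ _ _ _ (\bigcup_i F i)).
    move=> x nHx; have nsx : ~ Defs.support nu x by move=> /sub.
    have [C [[clC C1] nCx]] : exists C, (closed C /\ nu C = 1%E) /\ ~ C x.
      apply: contrapT => nC; apply: nsx => C [clC C1]; apply: contrapT => nCx.
      by apply: nC; exists C.
    have [i Uix UiC] : exists2 i, U i x & U i `<=` ~` C.
      by apply: UP; apply: open_nbhs_nbhs; split=> //; exact: closed_openC.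
    exists i => //; rewrite /F; case: asboolP => // -[].
    apply/eqP; rewrite eq_le measure_ge0 andbT.
    have mC : measurable (C : set (borel G)) by exact: closed_measurable_borel.
    have <- : nu (~` C) = 0%E by rewrite probability_setC// C1 subee.
    apply: le_measure; rewrite ?inE//; [exact: open_measurable_borel|exact: measurableC].
  apply: negligible_bigcup => i; rewrite /F; case: asboolP => // Ui0.
    by apply/negligibleP => //; exact: open_measurable_borel.
  exact: negligible_set0.
have aeH : {ae P, forall w, forall i, H (X i w)}.
  apply: ae_foralln => i; apply/negligibleP.
    apply: measurableC; rewrite -[X in measurable X]setTI.
    by apply: (measurable_funP (X i)).
  by rewrite -nuH -(X_iid.2 i)//; exact: measurableC.
have muH : mu H = 1%E.
  apply: full_of_always_visited => //; apply: filterS aeH => w Hw k.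
  elim: k => [|k IH]; last by rewrite random_walkS; exact: HM.
  by rewrite random_walkS /random_walk big_geq// mul1g; exact: Hw.
have [g nHg] : exists g, ~ H g.
  apply: contrapT => nn; move: HT => /eqP; apply; apply/seteqP; split=> // x _.
  by apply: contrapT => nHx; apply: nn; exists x.
have mT : measurable (trans g H) by exact: measurable_trans.
have disj : trans g H `&` H = set0.
  rewrite -subset0 => x [/= gx Hx]; apply: nHg.
  by have := HM _ _ Hx (HV _ gx); rewrite invgM invgK mulVKg.
have : (mu (trans g H `|` H) <= 1)%E by apply: probability_le1; exact: measurableU.
have muT : mu (trans g H) = 1%E by rewrite haar_trans.
have -> : mu (trans g H `|` H) = (mu (trans g H) + mu H)%E by exact: measureU.
by rewrite muT muH -EFinD lee_fin; lra.
Qed.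

Lemma abs_cont_of_slln : exists2 k : nat, (1 <= k)%N &
  exists m_abs m_sing : {measure set (borel G) -> \bar R},
    lebesgue_decomposition (convolution_power nu k) mu m_abs m_sing /\
    exists2 A, measurable A & m_abs A <> 0%E.
Proof.
apply: contrapT => nk.
(* If every absolutely continuous part vanishes, the law at time k + 1 is carried by a [mu]-null set
   [N k]. Time 0 is left out, as in [full_of_always_visited]. *)
have /choice[N NP] k : exists N, [/\ measurable N, gconvn mM nu k.+1 (~` N) = 0%E & mu N = 0%E].
  have [m_abs [m_sing dec]] := lebesgue_decomposition_exists (gconvn mM nu k.+1) mu.
  have abs0 A : measurable A -> m_abs A = 0%E.
    move=> mA; apply: contrapT => mA0; apply: nk; exists k.+1 => //.
    by exists m_abs, m_sing; split; [rewrite -gconvnE; exact: dec|exists A].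
  have [E _ [N [mN N1 N2]]] := dec; exists N; split=> //.
  by rewrite E; [rewrite abs0 ?add0e//|]; exact: measurableC.
pose U := \bigcup_n N n.
have mU : measurable U by apply: bigcupT_measurable => n; have [] := NP n.
have U0 : mu U = 0%E.
  apply: measure_negligible => //; apply: negligible_bigcup => n.
  by have [mN _ N0] := NP n; exact/negligibleP.
have U1 : mu U = 1%E.
  apply: full_of_always_visited => //; apply: ae_foralln => k.
  have [mN N0 _] := NP k.
  have mNC : measurable (~` N k) by exact: measurableC.
  apply: (@negligibleS _ _ _ _ (random_walk X k.+1 @^-1` (~` N k))).
    by move=> w /= nU Nw; apply: nU; exists k.
  apply/negligibleP; last exact: etrans (random_walk_law mM X_iid k.+1 mNC) N0.
  by rewrite -[X in measurable X]setTI; exact: measurable_random_walk.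
by move: U1; rewrite U0 => /eqP; rewrite eq_sym onee_eq0.
Qed.

End necessity.

Theorem theorem1 (R : realType) (G : topologicalGroupType)
    (G_compact : compact [set: G]) (G_metrizable : metrizable R G)
    (mu : probability (borel G) R) (mu_haar : normalized_haar mu)
    (nu : probability (borel G) R)
    (d : measure_display) (Omega : measurableType d) (P : probability Omega R)
    (X : nat -> {RV P >-> borel G}) (X_iid : iid X nu) :
  [<->
    (* (i) *)
    adapted nu /\
    (exists2 k : nat, (1 <= k)%N &
      exists m_abs m_sing : {measure set (borel G) -> \bar R},
        lebesgue_decomposition (convolution_power nu k) mu m_abs m_sing /\
        exists2 A, measurable A & m_abs A <> 0%E);
    (* (ii) *)
    forall f : borel G -> R, measurable_fun setT f -> bounded_fun f ->
      {ae P, forall w,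
        N%:R^-1 * (\sum_(1 <= k < N.+1) f (random_walk X k w)) @[N --> \oo]
          --> \int[mu]_x f x};
    (* (iii) *)
    forall f : borel G -> R, measurable_fun setT f -> bounded_fun f ->
      {ae P, forall w,
        (limn_esup (fun N : nat =>
           (`|\sum_(1 <= k < N.+1) f (random_walk X k w)
              - N%:R * \int[mu]_x f x|
            / Num.sqrt (N%:R * ln (ln N%:R)))%:E) < +oo)%E}
  ].
Proof.
have [U basisU] : exists U, @open_basis (borel G) U.
  exact: (compact_metrizable_basis (R := R) (T := borel G)).
have mM := measurable_mulB basisU.
have i_iii : (adapted nu /\
    (exists2 k : nat, (1 <= k)%N &
      exists m_abs m_sing : {measure set (borel G) -> \bar R},
        lebesgue_decomposition (convolution_power nu k) mu m_abs m_sing /\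
        exists2 A, measurable A & m_abs A <> 0%E)) ->
  forall f : borel G -> R, measurable_fun setT f -> bounded_fun f ->
    {ae P, forall w, exists C, \forall N \near \oo,
       `|\sum_(1 <= k < N.+1) f (random_walk X k w) - N%:R * \int[mu]_x f x|
         / Num.sqrt (N%:R * ln (ln N%:R)) <= C}.
  move=> [ad [k _ dec]] f mf [M [_ fM]].
  (* [bounded_fun] provides bounds only strictly above M. *)
  have fK : bddmf (M + 1) f.
    by split=> // x; apply: (fM (M + 1)) => //; rewrite ltrDl.
  have near : forall x, minorized_near mM mu nu x.
    apply: minorized_nearT => //.
    exact: minorized_near_of_abs_cont dec.
  have [s [c [c0 cs]]] := doeblin G_compact near.
  have [K [g [gK gE]]] := poisson_equation mu_haar c0 cs fK.
  exact: (lil_of_poisson mM X_iid gK gE).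
have slln_of_lil : (forall f : borel G -> R, measurable_fun setT f -> bounded_fun f ->
    {ae P, forall w, exists C, \forall N \near \oo,
       `|\sum_(1 <= k < N.+1) f (random_walk X k w) - N%:R * \int[mu]_x f x|
         / Num.sqrt (N%:R * ln (ln N%:R)) <= C}) ->
  forall f : borel G -> R, measurable_fun setT f -> bounded_fun f ->
    {ae P, forall w,
      N%:R^-1 * (\sum_(1 <= k < N.+1) f (random_walk X k w)) @[N --> \oo]
        --> \int[mu]_x f x}.
  by move=> lil f mf bf; apply: filterS (lil f mf bf) => w; exact: lil_bound_cvg.
have ii_i : (forall f : borel G -> R, measurable_fun setT f -> bounded_fun f ->
    {ae P, forall w,
      N%:R^-1 * (\sum_(1 <= k < N.+1) f (random_walk X k w)) @[N --> \oo]
        --> \int[mu]_x f x}) -> adapted nu /\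
    (exists2 k : nat, (1 <= k)%N &
      exists m_abs m_sing : {measure set (borel G) -> \bar R},
        lebesgue_decomposition (convolution_power nu k) mu m_abs m_sing /\
        exists2 A, measurable A & m_abs A <> 0%E).
  by move=> slln; split; [exact: (adapted_of_slln mu_haar X_iid slln basisU)
    |exact: (abs_cont_of_slln mM X_iid slln)].
(* The cycle is (i) to (ii) to (iii) to (i), whereas the arrows available are (i) to (iii), (iii) to
   (ii) and (ii) to (i); each required one is a composite of two of these. *)
tfae => [/i_iii/slln_of_lil //|/ii_i/i_iii lil f mf bf|lil].
  by apply: filterS (lil f mf bf) => w /limn_esup_lty.
apply/ii_i/slln_of_lil => f mf bf.
by apply: filterS (lil f mf bf) => w /limn_esup_lty.
Qed.
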